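(* Let $X$ be a sequential rectifiable space satisfying the separation axiom $T_0$ (equivalently, a regular sequential rectifiable space). The following conditions are equivalent: (1) $X$ has the strong Pytkeev property; (2) $X$ has countable $\mathrm{cs}^*$-character (at each of its points); (3) $X$ is metrizable or contains a clopen rectifiable $sk_\omega$-subspace.
   Context: A subset $A$ of a topological space $X$ accumulates at a point $x\in X$ if each neighborhood of $x$ contains infinitely many points of $A$. A topological space $X$ has the strong Pytkeev property at a point $x\in X$ if there is a countable family $\mathcal N$ of subsets of $X$ such that for every neighborhood $O_x\subset X$ of $x$ and every subset $A\subset X$ accumulating at $x$ there is a set $N\in\mathcal N$ such that $N\subset O_x$ and $N\cap A$ is infinite. $X$ has the strong Pytkeev property if it has it at each point $x\in X$. $X$ has countable $\mathrm{cs}^*$-character at $x$ if there is a countable family $\mathcal N$ of subsets of $X$ such that for every neighborhood $O_x$ of $x$ and every sequence $(x_n)_{n\in\omega}$ convergent to $x$ there is a set $N\in\mathcal N$ with $N\subset O_x$ and $x_n\in N$ for infinitely many $n$. A topological space $X$ is sequential if for each non-closed subset $A\subset X$ there is a sequence of points of $A$ convergent to a point of $X\setminus A$. A topological space $X$ is rectifiable if there are a point $e\in X$ and a homeomorphism $H:X^2\to X^2$ such that $H(x,e)=(x,x)$ and $H(\{x\}\times X)=\{x\}\times X$ for every $x\in X$. A topological space $X$ is an $sk_\omega$-space if there is a countable family $\mathcal K$ of compact metrizable subspaces of $X$ such that a subset $F\subset X$ is closed in $X$ if and only if for every $K\in\mathcal K$ the intersection $K\cap F$ is closed in $K$. *)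

(* Defs.v *)
From HB Require Import structures.
From mathcomp Require Import all_boot all_order all_algebra.
From mathcomp Require Import all_classical all_reals all_analysis.

Set Implicit Arguments.
Unset Strict Implicit.
Unset Printing Implicit Defensive.

Local Open Scope classical_set_scope.

Definition accumulation_point (X : topologicalType) (A : set X) (x : X) : Prop :=
  forall O : set X, nbhs x O -> infinite_set (O `&` A).

Definition strong_Pytkeev_at (X : topologicalType) (x : X) : Prop :=
  exists2 N : set (set X), countable N &
    forall O A : set X, nbhs x O -> accumulation_point A x ->
      exists B : set X, [/\ N B, B `<=` O & infinite_set (B `&` A)].

Definition strong_Pytkeev (X : topologicalType) : Prop :=
  forall x : X, strong_Pytkeev_at x.

(* The sequence may repeat values, so it is the set of indices, not the set of
   terms lying in [B], that is required to be infinite. *)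
Definition countable_cs_star_character_at (X : topologicalType) (x : X) : Prop :=
  exists2 N : set (set X), countable N &
    forall (O : set X) (u : nat -> X), nbhs x O -> u @ \oo --> x ->
      exists B : set X,
        [/\ N B, B `<=` O & infinite_set [set n | B (u n)]].

Definition countable_cs_star_character (X : topologicalType) : Prop :=
  forall x : X, countable_cs_star_character_at x.

Definition sequential_space (X : topologicalType) : Prop :=
  forall A : set X, ~ closed A ->
    exists (u : nat -> X) (x : X),
      [/\ forall n, A (u n), ~ A x & u @ \oo --> x].

Definition homeomorphism (X Y : topologicalType) (f : X -> Y) : Prop :=
  continuous f /\
  exists g : Y -> X, [/\ cancel f g, cancel g f & continuous g].

Definition rectifiable (X : topologicalType) : Prop :=
  exists (e : X) (H : X * X -> X * X),
    [/\ homeomorphism H,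
        forall x, H (x, e) = (x, x) &
        forall x, H @` ([set x] `*` setT) = [set x] `*` setT].

Definition metrizable (R : realType) (X : topologicalType) : Prop :=
  exists (M : metricType R) (f : X -> M), homeomorphism f.

(* A set [C] used as a type is the subspace [C], with the topology induced by
   [set_val]; [set_val @^-1` F] is the trace of [F] on it. *)
Definition sk_omega_space (R : realType) (X : topologicalType) : Prop :=
  exists K : set (set X),
    [/\ countable K,
        forall C, K C -> compact C /\ metrizable R (set_type C) &
        forall F : set X, closed F <->
          forall C, K C -> closed (set_val @^-1` F : set (set_type C))].

(* Regularity in the sense that includes T1; [regular_space] does not. *)
Definition T3_space (X : topologicalType) : Prop :=
  @accessible_space X /\ regular_space X.

(* Main.v *)
Require Import Defs.
From HB Require Import structures.
From mathcomp Require Import all_boot all_order all_algebra.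
From mathcomp Require Import all_classical all_reals all_analysis.
From mathcomp Require Import lra.

(** A rectification of X amounts to two continuous operations, a product x ** y
and a left quotient x \\ y, with x ** (x \\ y) = y, x \\ (x ** y) = y and
x ** e = x.  They replace the group operations: x \\ u tends to e exactly when
u tends to x.  This makes X regular and homogeneous, turns T0 into T1, and lets a
countable family at the single point e control sequences at every point.

The strong Pytkeev property gives countable cs*-character because the range of
a convergent sequence with infinitely many values accumulates at its limit.

From countable cs*-character one obtains a countable family N of sets, closed
under finite unions, products and quotients, such that every sequence tending
to e is eventually inside arbitrarily small members of N (exists_cs_algebra).
Everything rests on a trap (small_trap): if the terms u j lie in small members
of N and u tends to any point z, then z = u i ** (u i \\ z) and
u j = z ** (z \\ u j) show that almost all u j lie in one small member of N.
Call B a barrier if every sequence tending to e is eventually in B.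
 - If every neighbourhood O of e contains a barrier belonging to N, the
   countably many barriers of N are neighbourhoods of e, so X is first
   countable, and Frink's neighbourhood criterion metrizes it
   (barriers_metrizable).
 - Otherwise some O contains no such barrier, and then every sequence in a
   small enough member of N has a convergent subsequence
   (no_barrier_rel_seq_compact).  If not, there are divergent sequences y_n
   inside arbitrarily small members of N, and, since no finite union of small
   members is a barrier, sequences x_n tending to e that avoid more and more
   members of N.  The points y_n(m) ** x_n(i), with i depending on m and chosen
   well, form a set adherent to e out of which no sequence converges,
   contradicting sequentiality.
In the second case the closures of the small members of N are sequentially
compact; the trap makes every sequentially compact subset compact and
metrizable (seq_compact_compact, seq_compact_metrizable).  The union of the
countable family of compact sets generated from these closures by products and
quotients is closed under both operations, clopen, and has the topology
determined by that family (clopen_sk_omega).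

Conversely, metrizable spaces clearly have the strong Pytkeev property.  In a
regular sk_omega-space, a set accumulating at x and contained in a closed
neighbourhood V of x must meet some compact piece C in an infinite set, which
accumulates at a point of V and C; the members of countable bases of the pieces
therefore suffice (sk_omega_strong_Pytkeev).  Homogeneity spreads the property
from one point of the clopen subspace to all of X. *)

Set Implicit Arguments.
Unset Strict Implicit.
Unset Printing Implicit Defensive.
Import Order.TTheory GRing.Theory Num.Theory.
Local Open Scope classical_set_scope.

(** * Metrization *)

Section metrization.
Local Open Scope ring_scope.

(** A decreasing countable base of a separated uniformity, kept as relations so
that it can be produced on a space carrying a topology but no uniform
structure. *)
Definition uniform_base (T : Type) (D : nat -> T -> T -> Prop) :=
  [/\ forall k x, D k x x,
      forall k x y, D k x y -> D k y x,
      forall k x y, D k.+1 x y -> D k x y,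
      forall k, exists m, forall x y z, D m x y -> D m y z -> D k x z &
      forall x y, (forall k, D k x y) -> x = y].

Lemma uniform_base_le (T : Type) (D : nat -> T -> T -> Prop) k m x y :
  uniform_base D -> (k <= m)%N -> D m x y -> D k x y.
Proof.
move=> [_ _ Ddec _ _]; elim: m => [|m IH]; first by rewrite leqn0 => /eqP->.
by rewrite leq_eqVlt => /predU1P[->//|/ltnSE/IH mk /Ddec].
Qed.

(** The chain construction of a pseudometric from a countable uniformity
provides balls; the infimum of the radii turns them into a distance. *)
Lemma uniform_base_distance (R : realType) (T : choiceType)
    (D : nat -> T -> T -> Prop) :
  uniform_base D ->
  exists d : T -> T -> R,
    [/\ forall x, d x x = 0,
        forall x y, d x y = 0 -> x = y,
        forall x y, d x y = d y x &
        forall y x z, d x z <= d x y + d y z] /\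
    (forall k, exists2 e, 0 < e & forall x y, d x y < e -> D k x y) /\
    (forall e, 0 < e -> exists k, forall x y, D k x y -> d x y < e).
Proof.
move=> UD; have [Dxx Dsym Ddec Dsplit Dsep] := UD.
have Dle k m x y := @uniform_base_le T D k m x y UD.
pose ent := filter_from [set: nat] (fun k => [set xy : T * T | D k xy.1 xy.2]).
have entF : Filter ent.
  apply: filter_from_filter; first by exists 0%N.
  move=> i j _ _; exists (maxn i j) => // -[x y] /= Dxy.
  by split; apply: Dle Dxy; rewrite (leq_maxl, leq_maxr).
have ent_refl A : ent A -> diagonal `<=` A.
  by move=> [k _ kA] [x y] /diagonalP ->; apply: kA; exact: Dxx.
have ent_inv A : ent A -> ent (A^-1)%relation.
  by move=> [k _ kA]; exists k => // -[x y] /= /Dsym yx; exact: (kA (y, x)).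
have ent_split A : ent A -> exists2 B, ent B & (B \; B `<=` A)%relation.
  move=> [k _ kA]; have [m mk] := Dsplit k.
  exists [set xy : T * T | D m xy.1 xy.2]; first by exists m.
  by move=> [x z] [y /= xy yz]; apply/kA/(mk _ y).
pose U : uniformType :=
  HB.pack T (Choice.class T) (@isUniform.Axioms_ T
    (Choice.choice_hasChoice_mixin (Choice.class T))
    (Choice.eqtype_hasDecEq_mixin (Choice.class T))
    ent entF ent_refl ent_inv ent_split).
have cU : countable_uniformity U.
  apply/countable_uniformityP.
  exists (fun k => [set xy : T * T | D k xy.1 xy.2]).
    by move=> A [k _ kA]; exists k.
  by move=> k; exists k.
pose M : pseudoMetricType R := countable_uniform cU.
have entE : @entourage M = entourage_ (@ball R M) by rewrite entourage_ballE.
pose S (x y : M) := [set e : R | 0 < e /\ ball x e y].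
have Slb x y : has_inf (S x y).
  split; last by exists 0 => e [/ltW].
  by exists 2; split=> //; exact: countable_uniform.countable_uniform_bounded.
pose d (x y : M) : R := inf (S x y).
have d_ge0 x y : 0 <= d x y.
  by apply: lb_le_inf; [exact: (Slb x y).1|move=> e [/ltW]].
have d_lt x y e : d x y < e -> ball x e y.
  move=> /(inf_lt (Slb x y).1) [r [r0 xry] re].
  by apply: le_ball xry; exact: ltW.
have d_le x y e : 0 < e -> ball x e y -> d x y <= e.
  by move=> e0 xey; apply: ge_inf; [exact: (Slb x y).2|].
exists d; split; last split.
- split.
  + move=> x; apply/eqP; rewrite eq_le d_ge0 andbT.
    apply/ler_addgt0Pl => e e0; rewrite addr0; apply: d_le => //.
    exact: ballxx.
  + move=> x y d0; apply: Dsep => k.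
    have : @entourage M [set xy : T * T | D k xy.1 xy.2] by exists k.
    rewrite entE => -[e e0 /(_ (x, y))]; apply => /=.
    by apply: d_lt; rewrite d0.
  + have dN x y : d x y <= d y x.
      apply/ler_addgt0Pl => e e0; apply: d_le.
        by rewrite ltr_pwDl.
      by apply: ball_sym; apply: d_lt; rewrite ltrDr.
    by move=> x y; apply/eqP; rewrite eq_le !dN.
  + move=> y x z; apply/ler_addgt0Pl => e e0.
    have -> : e + (d x y + d y z) = (d x y + e / 2) + (d y z + e / 2) by lra.
    have h w w' : d w w' < d w w' + e / 2 by rewrite ltrDl divr_gt0.
    apply: d_le; first by have := d_ge0 x y; have := d_ge0 y z; lra.
    by apply: (@ball_triangle R M y); exact: d_lt.
- move=> k; have : @entourage M [set xy : T * T | D k xy.1 xy.2] by exists k.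
  rewrite entE => -[e e0 eD]; exists e => // x y /d_lt xy.
  exact: (eD (x, y)).
- move=> e e0; have e20 : 0 < e / 2 by rewrite divr_gt0.
  have : @entourage M [set xy : M * M | ball xy.1 (e / 2) xy.2].
    by rewrite entE; exists (e / 2).
  move=> [k _ kb]; exists k => x y xy.
  apply: (@le_lt_trans _ _ (e / 2)); last by lra.
  by apply: d_le => //; exact: (kb (x, y)).
Qed.

Lemma metric_space_of_distance (R : realType) (T : choiceType) (d : T -> T -> R) :
  (forall x, d x x = 0) -> (forall x y, d x y = 0 -> x = y) ->
  (forall x y, d x y = d y x) -> (forall y x z, d x z <= d x y + d y z) ->
  exists (M : metricType R) (f : T -> M) (g : M -> T),
    [/\ cancel f g, cancel g f & forall x y, mdist (f x) (f y) = d x y].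
Proof.
move=> dxx d0 dsym dtri.
pose M : metricType R :=
  HB.pack T (Choice.class T) (@isMetric.Axioms_ R T
    (Choice.choice_hasChoice_mixin (Choice.class T))
    (Choice.eqtype_hasDecEq_mixin (Choice.class T))
    d dxx d0 dsym dtri).
by exists M, id, id.
Qed.

Lemma metrizable_uniform_base (R : realType) (X : topologicalType)
    (D : nat -> X -> X -> Prop) :
  uniform_base D ->
  (forall x (V : set X), nbhs x V <-> exists k, D k x `<=` V) ->
  metrizable R X.
Proof.
move=> UD DP.
have [d [[dxx d0 dsym dtri] [dD Dd]]] := @uniform_base_distance R X D UD.
have [M [f [g [fK gK fd]]]] := metric_space_of_distance dxx d0 dsym dtri.
have nbhsM (x : X) (V : set M) : nbhs (f x) V <-> nbhs x (f @^-1` V).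
  rewrite -metricType_numDomainType.filter_from_mdist_nbhs; split.
    move=> [e e0 eV]; have [k kd] := Dd e e0.
    by apply/DP; exists k => y /kd xy; apply: eV; rewrite /= fd.
  move=> /DP[k kV]; have [e e0 ed] := dD k.
  by exists e => // y; rewrite /= -(gK y) fd => /ed/kV.
exists M, f; split; first by move=> x V /nbhsM.
exists g; split=> // y V gV.
have := (nbhsM (g y) (g @^-1` V)).2; rewrite gK; apply.
by apply: filterS gV => z; rewrite /= fK.
Qed.
End metrization.

(** Frink's criterion.  The index m in the hypothesis depends on x; passing from
U to the subsequence V k x = U (r x k) x with r x (k+1) beyond that index makes
it uniform: when two sets V (k+1) x and V (k+1) y meet, the one with the larger
index is contained in the V k of the other centre, and so is their union.
Being in a common V k is thus a uniform base. *)
Lemma metrizable_Frink (R : realType) (X : topologicalType)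
    (U : nat -> X -> set X) :
  (forall n x, U n x x) ->
  (forall n x, U n.+1 x `<=` U n x) ->
  (forall x (V : set X), nbhs x V <-> exists n, U n x `<=` V) ->
  (forall n x, exists m, forall y, U m x `&` U m y !=set0 -> U m y `<=` U n x) ->
  accessible_space X -> metrizable R X.
Proof.
move=> Uxx Udec UP UF T1.
have Ule k m x : (k <= m)%N -> U m x `<=` U k x.
  elim: m => [|m IH]; first by rewrite leqn0 => /eqP->.
  rewrite leq_eqVlt => /predU1P[->//|/ltnSE/IH mk].
  exact: subset_trans (Udec _ _) mk.
have [mu_ mu_P] := choice (fun nx : nat * X => UF nx.1 nx.2).
pose mu n x := mu_ (n, x).
have {mu_P} muP n x y :
  U (mu n x) x `&` U (mu n x) y !=set0 -> U (mu n x) y `<=` U n x.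
  exact: (mu_P (n, x)).
pose r x := fix r k := if k is k'.+1 then maxn (r k').+1 (mu (r k') x) else 0%N.
have r_ge k x : (k <= r x k)%N.
  by elim: k => // k IH /=; rewrite leq_max ltnS IH.
pose V k x := U (r x k) x.
have Vdec k x : V k.+1 x `<=` V k x.
  by apply: Ule; rewrite /= leq_max ltnW.
have merge k x y : V k.+1 x `&` V k.+1 y !=set0 -> (r x k.+1 <= r y k.+1)%N ->
    V k.+1 y `<=` V k x.
  move=> [z [zx zy]] xy w wy.
  have le1 : (mu (r x k) x <= r x k.+1)%N by rewrite /= leq_maxr.
  apply: (muP _ _ y); last exact: Ule (leq_trans le1 xy) _ wy.
  by exists z; split; [apply: Ule zx|apply: Ule zy => //; exact: leq_trans xy].
pose D k x y := exists z, V k z x /\ V k z y.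
have T1D x y : (forall k, D k x y) -> x = y.
  move=> xy; apply: contrapT => /eqP /T1 [A [oA]]; rewrite !inE => Ax Ay.
  have [n nA] := (UP x A).1 (open_nbhs_nbhs (conj oA Ax)).
  have [m mP] := UF n x; have [z [zx zy]] := xy m.
  apply/Ay/nA/(mP z); last exact: Ule (r_ge _ _) _ zy.
  by exists x; split=> //; exact: Ule (r_ge _ _) _ zx.
apply: (@metrizable_uniform_base _ _ D); first split => //.
- by move=> k x; exists x; split; exact: Uxx.
- by move=> k x y [z [zx zy]]; exists z.
- by move=> k x y [z [/Vdec zx /Vdec zy]]; exists z.
- move=> k; exists k.+1 => x y z [a [ax ay]] [b [bY bz]].
  have [ab|/ltnW ba] := leqP (r a k.+1) (r b k.+1).
    exists a; split; first exact: Vdec.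
    by apply: merge ab _ bz; exists y.
  exists b; split; last exact: Vdec.
  by apply: merge ba _ ax; exists y.
- move=> x W; split.
    move=> /UP[n nW]; have [m mP] := UF n x.
    exists m => y [z [zx zy]]; apply/nW/(mP z); last exact: Ule (r_ge _ _) _ zy.
    by exists x; split=> //; exact: Ule (r_ge _ _) _ zx.
  move=> [k kW]; apply/UP; exists (r x k) => y xy.
  by apply: kW; exists x; split=> //; exact: Uxx.
Qed.

(** * Sequences and countable families *)

Lemma frequently_subsequence (P : nat -> Prop) :
  (forall n, exists2 m, (n <= m)%N & P m) ->
  exists2 g : nat -> nat, g @ \oo --> \oo & forall j, P (g j).
Proof.
move=> /(_ _)/cid2-/all_sig2[g g_ge gP]; exists g => //.
apply/cvgnyPge => n; near=> m; apply: leq_trans (g_ge m).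
by near: m; exact: nbhs_infty_ge.
Unshelve. all: by end_near. Qed.

Lemma not_eventually (P : nat -> Prop) :
  ~ (\forall n \near \oo, P n) -> forall n, exists2 m, (n <= m)%N & ~ P m.
Proof.
move=> nP n; apply: contrapT => /forall2NP h; apply: nP.
by exists n => // m /= nm; have [|/contrapT] := h m.
Qed.

(** Maps g of nat to itself with g tending to infinity serve as
subsequences throughout; this dichotomy replaces the extraction of a strictly
increasing or constant subsequence. *)
Lemma cvgny_or_constant_subsequence (g : nat -> nat) :
  (g @ \oo --> \oo) \/
  exists (c : nat) (h : nat -> nat), h @ \oo --> \oo /\ forall j, g (h j) = c.
Proof.
have [|] := pselect (g @ \oo --> \oo); [by left|right].
have /existsNP[A /not_eventually oft] : ~ forall A, \forall n \near \oo, (A <= g n)%N.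
  by move/cvgnyPge.
have {}oft n : exists2 m, (n <= m)%N & (g m < A)%N.
  by have [m nm /negP] := oft n; rewrite -ltnNge; exists m.
elim: A oft => [/(_ 0%N)[]//|A IH oft].
have [often|] := pselect (forall n, exists2 m, (n <= m)%N & g m = A).
  by have [h h1 h2] := frequently_subsequence often; exists A, h.
move=> /existsNP[n0 no]; apply: IH => n.
have [m] := oft (maxn n n0); rewrite geq_max => /andP[nm n0m].
rewrite ltnS leq_eqVlt => /predU1P[gA|]; last by exists m.
by exfalso; apply: no; exists m.
Qed.

(** In P s x, the list s holds the terms chosen before x. *)
Lemma choice_with_history (T : Type) (P : seq T -> T -> Prop) :
  (forall s, exists x, P s x) ->
  exists z : nat -> T, forall m, P (mkseq z m) (z m).
Proof.
move=> /choice[f fP].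
pose hist := fix hist m := if m is m'.+1 then rcons (hist m') (f (hist m')) else [::].
have histE m : hist m = mkseq (fun i => f (hist i)) m.
  by elim: m => // m IH; rewrite mkseqS -IH.
by exists (fun i => f (hist i)) => m; rewrite -histE; exact: fP.
Qed.

Lemma countable_enumeration (T : Type) (A : set T) :
  countable A -> A !=set0 -> exists f : nat -> T, range f = A.
Proof.
move=> /pfcard_geP[->[]//|/unsquash f _]; exists f.
by apply/seteqP; split=> [_ [n _ <-]|x /(@surj _ _ _ _ f)//]; exact: funS.
Qed.

Lemma countable_setU (T : Type) (A B : set T) :
  countable A -> countable B -> countable (A `|` B).
Proof.
move=> cA cB; rewrite -bigcup2E; apply: bigcup_countable => // -[|[|n]] _ //=.
Qed.

Lemma countable_closure_ops (T : Type) (I : countType) (op : I -> T -> T -> T)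
    (A : set T) :
  countable A ->
  exists B, [/\ countable B, A `<=` B &
    forall i a b, B a -> B b -> B (op i a b)].
Proof.
move=> cA; pose L := fix L n := if n is n'.+1
  then L n' `|` \bigcup_(i in [set: I]) [set op i ab.1 ab.2 | ab in L n' `*` L n']
  else A.
have Lle m n : (m <= n)%N -> L m `<=` L n.
  elim: n => [|n IH]; first by rewrite leqn0 => /eqP->.
  by rewrite leq_eqVlt => /predU1P[->//|/ltnSE/IH mn]; apply: subset_trans mn _; left.
exists (\bigcup_n L n); split.
- apply: bigcup_countable => // n _; elim: n => //= n IH.
  apply: countable_setU => //; apply: bigcup_countable => // i _.
  apply: sub_countable (card_image_le _ _) _; exact: countableX.
- by move=> a Aa; exists 0%N.
- move=> i a b [m _ ma] [n _ nb]; exists (maxn m n).+1 => //=; right; exists i => //.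
  by exists (a, b) => //; split; [apply: Lle ma|apply: Lle nb];
    rewrite ?leq_maxl ?leq_maxr.
Qed.

(** * Separation and convergence *)

Definition seq_compact (X : topologicalType) (K : set X) :=
  forall u : nat -> X, (forall n, K (u n)) ->
    exists (g : nat -> nat) (x : X),
      [/\ g @ \oo --> \oo, K x & u \o g @ \oo --> x].

Definition divergent (X : topologicalType) (u : nat -> X) :=
  forall (g : nat -> nat) (x : X), g @ \oo --> \oo -> ~ (u \o g @ \oo --> x).

Lemma T3_hausdorff (X : topologicalType) : T3_space X -> hausdorff_space X.
Proof.
move=> [T1 reg] x y xy; apply: contrapT => /eqP; rewrite eq_sym => /T1[A [oA]].
rewrite !inE => Ay /= Ax; have /reg [V Vy VA] : nbhs y A by exact: open_nbhs_nbhs.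
have nx : nbhs x (~` closure V).
  apply: open_nbhs_nbhs; split; last by move/VA.
  by apply: closed_openC; exact: closed_closure.
have [z [nVz Vz]] := xy _ _ nx Vy.
by apply: nVz; exact: subset_closure.
Qed.

Lemma regular_closed_nbhs (X : topologicalType) (x : X) (O : set X) :
  regular_space X -> nbhs x O -> exists V, [/\ nbhs x V, closed V & V `<=` O].
Proof.
move=> reg /reg [V xV VO]; exists (closure V); split=> //.
  by apply: filterS xV; exact: subset_closure.
exact: closed_closure.
Qed.

Lemma seq_cvg_unique (X : topologicalType) (u : nat -> X) (x y : X) :
  hausdorff_space X -> u @ \oo --> x -> u @ \oo --> y -> x = y.
Proof. by move=> hX; exact: cvg_unique. Qed.

Lemma seq_compact_closed (X : topologicalType) (K : set X) :
  hausdorff_space X -> sequential_space X -> seq_compact K -> closed K.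
Proof.
move=> hX sX cK; apply: contrapT => /sX[u [x [Ku nKx ux]]].
have [g [y [goo Ky uy]]] := cK u Ku.
apply: nKx; suff -> : x = y by [].
by apply: seq_cvg_unique hX _ uy; exact: cvg_comp goo ux.
Qed.

Lemma seq_compact_image2 (X Y Z : topologicalType) (f : X -> Y -> Z)
    (K : set X) (L : set Y) :
  continuous (fun p => f p.1 p.2) -> seq_compact K -> seq_compact L ->
  seq_compact [set f x y | x in K & y in L].
Proof.
move=> cf cK cL u /(_ _)/cid2-/all_sig2[a Ka] /(_ _)/cid2-/all_sig2[b Lb abu].
have [g [x [goo Kx ax]]] := cK a Ka.
have [h [y [hoo Ly bY]]] := cL (b \o g) (fun n => Lb (g n)).
exists (g \o h), (f x y); split; first exact: cvg_comp hoo goo.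
  by exists x => //; exists y.
have -> : u \o (g \o h) = (fun n => f (a (g (h n))) (b (g (h n)))).
  by apply/funext => n /=; rewrite abu.
apply: continuous2_cvg (cf (x, y)) _ bY; exact: cvg_comp hoo ax.
Qed.

Lemma near2_continuous (X Y Z : topologicalType) (f : X -> Y -> Z) (x : X) (y : Y)
    (O : set Z) :
  continuous (fun p => f p.1 p.2) -> nbhs (f x y) O ->
  exists2 A, nbhs x A & exists2 B, nbhs y B & forall a b, A a -> B b -> O (f a b).
Proof.
move=> cf fO; have [[A B] /= [xA yB] AB] := cf (x, y) O fO.
by exists A => //; exists B => // a b Aa Bb; exact: (AB (a, b)).
Qed.

Lemma sequentially_open (X : topologicalType) (W : set X) :
  sequential_space X ->
  (forall u x, W x -> u @ \oo --> x -> \forall n \near \oo, W (u n)) -> open W.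
Proof.
move=> sX oW; rewrite -[W]setCK; apply: closed_openC; apply: contrapT.
move=> /sX[u [x [nWu /contrapT Wx ux]]].
by have [n _ /(_ n (leqnn n))] := oW _ _ Wx ux; exact: nWu.
Qed.

Lemma sequentially_closed (X : topologicalType) (W : set X) :
  sequential_space X ->
  (forall u x, (forall n, W (u n)) -> u @ \oo --> x -> W x) -> closed W.
Proof.
by move=> sX cW; apply: contrapT => /sX[u [x [Wu nWx ux]]]; exact/nWx/cW/ux.
Qed.

Lemma nbhs_set_val (X : topologicalType) (A : set X) (x : A) (V : set A) :
  nbhs x V <-> exists2 O, nbhs (set_val x) O & set_val @^-1` O `<=` V.
Proof.
split=> [[_ [[W oW <-] /= Wx WV]]|[W xW WV]].
  by exists W => //; exact: open_nbhs_nbhs.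
apply: filterS WV _; exact: initial_continuous.
Qed.

Lemma cvg_set_val (X : topologicalType) (A : set X) (T : Type)
    (F : set_system T) {FF : Filter F} (u : T -> A) (x : A) :
  u @ F --> x <-> (fun t => set_val (u t)) @ F --> set_val x.
Proof.
split=> [ux|ux V /nbhs_set_val[W xW WV]].
  exact: cvg_comp ux (@initial_continuous _ _ set_val x).
have := ux _ xW; rewrite !nbhs_simpl. apply: (@filterS _ _ FF) => t; exact: WV.
Qed.

Lemma cvg_continuous2 (X Y Z : topologicalType) (f : X -> Y -> Z)
    (T : Type) (F : set_system T) {FF : Filter F} (u : T -> X) (v : T -> Y) x y :
  continuous (fun p => f p.1 p.2) -> u @ F --> x -> v @ F --> y ->
  (fun t => f (u t) (v t)) @ F --> f x y.
Proof.
move=> cf ux vy.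
exact: (@continuous2_cvg T X Y Z F FF u v f x y (cf (x, y)) ux vy).
Qed.

Lemma cvg_subseq (X : topologicalType) (u : nat -> X) (x : X) (g : nat -> nat) :
  g @ \oo --> \oo -> u @ \oo --> x -> u \o g @ \oo --> x.
Proof. by move=> goo ux; exact: cvg_comp goo ux. Qed.

Lemma closed_seq_cvg (X : topologicalType) (A : set X) (u : nat -> X) (x : X) :
  closed A -> u @ \oo --> x -> (\forall n \near \oo, A (u n)) -> A x.
Proof. by move=> cA ux Au; apply: closed_cvg ux => //. Qed.

Lemma closed_preimage_set_val (X : topologicalType) (A F : set X) :
  closed F -> closed (set_val @^-1` F : set (set_type A)).
Proof. exact: (continuous_closedP _).1 (@initial_continuous _ _ set_val) F. Qed.

(** * Rectifiable spaces *)

(** The operations are the second components of a fibre-preserving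
homeomorphism H and of its inverse: mul x is a homeomorphism sending e to x, and
ldiv x is the inverse homeomorphism. *)
Definition rectification (X : topologicalType) (e : X) (mul ldiv : X -> X -> X) :=
  [/\ continuous (fun p : X * X => mul p.1 p.2),
      continuous (fun p : X * X => ldiv p.1 p.2),
      forall x y, mul x (ldiv x y) = y,
      forall x y, ldiv x (mul x y) = y &
      forall x, mul x e = x].

(** Since H maps each fibre over x onto itself, only its second component and
that of its inverse carry information. *)
Lemma rectifiable_rectification (X : topologicalType) :
  rectifiable X -> exists e mul ldiv, @rectification X e mul ldiv.
Proof.
move=> [e [H [[cH [G [HK GK cG]]] He Hfib]]].
have H1 p : (H p).1 = p.1.
  have : (H @` ([set p.1] `*` setT)) (H p) by exists p.
  by rewrite Hfib => -[].
have G1 p : (G p).1 = p.1 by rewrite -{2}[p]GK H1.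
exists e, (fun x y => (H (x, y)).2), (fun x y => (G (x, y)).2); split.
- have -> : (fun p : X * X => (H (p.1, p.2)).2) = snd \o H.
    by apply/funext => -[].
  by move=> p; apply: continuous_comp; [exact: cH|exact: cvg_snd].
- have -> : (fun p : X * X => (G (p.1, p.2)).2) = snd \o G.
    by apply/funext => -[].
  by move=> p; apply: continuous_comp; [exact: cG|exact: cvg_snd].
- move=> x y; have -> : (x, (G (x, y)).2) = G (x, y).
    by rewrite [RHS]surjective_pairing G1.
  by rewrite GK.
- move=> x y; have -> : (x, (H (x, y)).2) = H (x, y).
    by rewrite [RHS]surjective_pairing H1.
  by rewrite HK.
- by move=> x; rewrite He.
Qed.

Lemma rectification_rectifiable (X : topologicalType) e mul ldiv :
  @rectification X e mul ldiv -> rectifiable X.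
Proof.
move=> [cm cd mK dK me].
exists e, (fun p => (p.1, mul p.1 p.2)); split.
- split; first by move=> p; apply: cvg_pair; [exact: cvg_fst|exact: cm].
  exists (fun p => (p.1, ldiv p.1 p.2)); split.
  + by move=> [x y] /=; rewrite dK.
  + by move=> [x y] /=; rewrite mK.
  + by move=> p; apply: cvg_pair; [exact: cvg_fst|exact: cd].
- by move=> x /=; rewrite me.
- move=> x; apply/seteqP; split; first by move=> _ [p [/= px _] <-] /=.
  move=> [a b] [/= -> _]; exists (x, ldiv x b) => //=.
  by rewrite mK.
Qed.

Section rectification_theory.
Context (X : topologicalType) (e : X) (mul ldiv : X -> X -> X).
Hypothesis rX : rectification e mul ldiv.

Local Notation "x ** y" := (mul x y) (at level 40, left associativity).
Local Notation "x \\ y" := (ldiv x y) (at level 40, left associativity).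

Lemma mul_continuous : continuous (fun p : X * X => p.1 ** p.2).
Proof. by case: rX. Qed.

Lemma ldiv_continuous : continuous (fun p : X * X => p.1 \\ p.2).
Proof. by case: rX. Qed.

Lemma ldivK x y : x ** (x \\ y) = y. Proof. by case: rX. Qed.

Lemma mulK x y : x \\ (x ** y) = y. Proof. by case: rX. Qed.

Lemma mule x : x ** e = x. Proof. by case: rX. Qed.

Lemma ldivxx x : x \\ x = e. Proof. by rewrite -{2}[x]mule mulK. Qed.

Lemma cvg_mul (T : Type) (F : set_system T) {FF : Filter F} (u v : T -> X) x y :
  u @ F --> x -> v @ F --> y -> (fun t => u t ** v t) @ F --> x ** y.
Proof.
exact: cvg_continuous2 mul_continuous.
Qed.

Lemma cvg_ldiv (T : Type) (F : set_system T) {FF : Filter F} (u v : T -> X) x y :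
  u @ F --> x -> v @ F --> y -> (fun t => u t \\ v t) @ F --> x \\ y.
Proof.
exact: cvg_continuous2 ldiv_continuous.
Qed.

Lemma cvg_ldivl (u : nat -> X) x :
  u @ \oo --> x -> (fun n => x \\ u n) @ \oo --> e.
Proof. by move=> ux; rewrite -(ldivxx x); apply: cvg_ldiv ux; exact: cvg_cst. Qed.

Lemma cvg_ldivr (u : nat -> X) x :
  u @ \oo --> x -> (fun n => u n \\ x) @ \oo --> e.
Proof. by move=> ux; rewrite -(ldivxx x); apply: cvg_ldiv ux _; exact: cvg_cst. Qed.

Lemma near_mul (x y : X) (O : set X) : nbhs (x ** y) O ->
  exists2 A : set X, nbhs x A & exists2 B : set X, nbhs y B & forall a b, A a -> B b -> O (a ** b).
Proof. exact: near2_continuous mul_continuous. Qed.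

Lemma near_mul_e (x : X) (O : set X) : nbhs x O ->
  exists2 A : set X, nbhs x A & exists2 B : set X, nbhs e B & forall a b, A a -> B b -> O (a ** b).
Proof. by rewrite -{1}[x]mule; exact: near_mul. Qed.

Lemma near_mull (x : X) (O : set X) : nbhs x O -> exists2 B : set X, nbhs e B & forall b, B b -> O (x ** b).
Proof.
move=> /near_mul_e[A xA [B eB AB]]; exists B => // b; apply: AB.
exact: nbhs_singleton.
Qed.

Lemma near_ldiv_e (O : set X) : nbhs e O ->
  exists2 A : set X, nbhs e A & forall a b, A a -> A b -> O (a \\ b).
Proof.
rewrite -{1}(ldivxx e) => /(near2_continuous ldiv_continuous)[A eA [B eB AB]].
by exists (A `&` B) => [|a b [Aa _] [_ Bb]]; [exact: filterI|exact: AB].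
Qed.

Lemma near_mul_ee (O : set X) : nbhs e O ->
  exists2 A : set X, nbhs e A & forall a b, A a -> A b -> O (a ** b).
Proof.
move=> /near_mul_e[A eA [B eB AB]].
by exists (A `&` B) => [|a b [Aa _] [_ Bb]]; [exact: filterI|exact: AB].
Qed.

Lemma near_mul_eee (O : set X) : nbhs e O ->
  exists2 A : set X, nbhs e A &
    forall a b c, A a -> A b -> A c -> O ((a ** b) ** c).
Proof.
move=> /near_mul_ee[A1 eA1 h1]; have [A2 eA2 h2] := near_mul_ee eA1.
exists (A1 `&` A2); first exact: filterI.
by move=> a b c [_ Aa] [_ Ab] [Ac _]; apply: h1 => //; exact: h2.
Qed.

Lemma homogeneous x y : exists2 f : X -> X, homeomorphism f & f x = y.
Proof.
exists (fun z => y ** (x \\ z)); last by rewrite ldivxx mule.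
split; first by move=> z; apply: cvg_mul; [exact: cvg_cst|]; apply: cvg_ldiv;
  [exact: cvg_cst|exact: cvg_id].
exists (fun z => x ** (y \\ z)); split=> [z|z|z].
- by rewrite mulK ldivK.
- by rewrite mulK ldivK.
- by apply: cvg_mul; [exact: cvg_cst|]; apply: cvg_ldiv;
    [exact: cvg_cst|exact: cvg_id].
Qed.

(** An open set separating y from x is carried by a Mal'cev operation to one
separating x from y. *)
Lemma rectification_T1 : kolmogorov_space X -> accessible_space X.
Proof.
move=> T0 x y xy; suff [V xV nVy] : exists2 V : set X, nbhs x V & ~ V y.
  move: xV; rewrite nbhsE => -[A [oA Ax] AV]; exists A; split=> //.
    by rewrite inE.
  by rewrite inE => /AV.
have [A] := T0 x y xy; rewrite !inE => -[[xA nAy]|[yA nAx]]; first by exists A.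
(* As a function of z, x ** (z \\ y) sends x to y and y to x. *)
exists [set z | A (x ** (z \\ y))]; last by rewrite /= ldivxx mule.
suff h : (fun z => x ** (z \\ y)) @ x --> y by exact: h yA.
rewrite -{2}(ldivK x y); apply: cvg_mul; first exact: cvg_cst.
by apply: cvg_ldiv; [exact: cvg_id|exact: cvg_cst].
Qed.

(** If V ** W is contained in O then so is the closure of V: a point y of
it is z ** (z \\ y) for some z in V so close to y that z \\ y is in W. *)
Lemma rectification_regular : regular_space X.
Proof.
move=> x O /near_mul_e[V xV [W eW VW]]; exists V => // y /(_ [set z | W (z \\ y)])[|].
  suff h : (fun z => z \\ y) @ y --> e by exact: h eW.
  by rewrite -(ldivxx y); apply: cvg_ldiv; [exact: cvg_id|exact: cvg_cst].
by move=> z [Vz /(VW z _ Vz)]; rewrite ldivK.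
Qed.

Lemma rectification_T3 : kolmogorov_space X <-> T3_space X.
Proof.
split=> [T0|[T1 _]]; last exact: accessible_kolmogorov.
by split; [exact: rectification_T1|exact: rectification_regular].
Qed.

End rectification_theory.

(** * From the strong Pytkeev property to countable cs*-character *)

(** A sequence that tends to x and takes finitely many values is eventually equal
to x; the singleton of x, added to the family, handles this case. *)
Lemma strong_Pytkeev_cs_star (X : topologicalType) :
  accessible_space X -> strong_Pytkeev X -> countable_cs_star_character X.
Proof.
move=> T1 pX x; have [N cN NP] := pX x.
exists (N `|` [set [set x]]); first exact: countable_setU.
move=> O u xO ux.
have [fu|iu] := pselect (finite_set (range u)); last first.
  have acc : accumulation_point (range u) x.
    move=> V xV; have [n _ nV] := ux _ xV.
    apply: sub_infinite_set (_ : range u `\` (u @` `I_n) `<=` _) _.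
      move=> _ [[m _ <-] mn]; split; last by exists m.
      apply: nV => /=; rewrite leqNgt; apply/negP => mn'; apply: mn.
      by exists m.
    by apply: infinite_setD iu _; exact/finite_image/finite_II.
  have [B [NB BO iB]] := NP O _ xO acc; exists B; split=> //; first by left.
  move=> fB; apply: iB; apply: sub_finite_set (finite_image u fB).
  by move=> y [By [n _ nuy]]; exists n => //=; rewrite nuy.
exists [set x]; split; [by right|by move=> _ ->; exact: nbhs_singleton|].
have [V xV Vu] : exists2 V : set X, nbhs x V & forall n, V (u n) -> u n = x.
  exists (~` (range u `\ x)); last first.
    by move=> n nx; apply: contrapT => unx; apply: nx; split=> //; exists n.
  apply: open_nbhs_nbhs; split; last by move=> [_ /(_ erefl)].
  apply: closed_openC; apply: (accessible_finite_set_closed.1 T1).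
  exact: sub_finite_set fu.
have [n _ nV] := ux _ xV.
apply: sub_infinite_set (_ : ~` `I_n `<=` _) _.
  by move=> m /=/negP; rewrite -leqNgt => nm; exact/Vu/nV.
by move=> fC; apply: infinite_nat; rewrite -(setvU `I_n) finite_setU; split=> //; exact: finite_II.
Qed.

(** * Countable networks at the unit *)

Definition cumulU (X : Type) (Q : nat -> set X) := fix cumulU n : set X :=
  if n is n'.+1 then cumulU n' `|` Q n else Q 0%N.

Lemma cumulU_sup (X : Type) (Q : nat -> set X) m n :
  (m <= n)%N -> Q m `<=` cumulU Q n.
Proof.
elim: n => [|n IH]; first by rewrite leqn0 => /eqP->.
rewrite leq_eqVlt => /predU1P[->|/ltnSE/IH mn] /=; first by right.
by apply: subset_trans mn _; left.
Qed.

Section networks.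
Context (X : topologicalType) (e : X) (mul ldiv : X -> X -> X).
Hypothesis rX : rectification e mul ldiv.

Local Notation "x ** y" := (mul x y) (at level 40, left associativity).
Local Notation "x \\ y" := (ldiv x y) (at level 40, left associativity).
Local Notation "A **` B" := [set a ** b | a in A & b in B]
  (at level 40, left associativity).
Local Notation "A \\` B" := [set a \\ b | a in A & b in B]
  (at level 40, left associativity).

(** The last condition is that of a cs-network at e, stronger than the
cs*-condition in that it concerns almost all terms of the sequence. *)
Definition cs_algebra (N : set (set X)) :=
  [/\ countable N,
      forall A B, N A -> N B -> N (A `|` B),
      forall A B, N A -> N B -> N (A **` B),
      forall A B, N A -> N B -> N (A \\` B) &
      forall (O : set X) (u : nat -> X), nbhs e O -> u @ \oo --> e ->
        exists A, [/\ N A, A `<=` O & \forall n \near \oo, A (u n)]].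

(** Closing a cs*-network under finite unions yields a cs-network: if all the
finite unions of members inside O were missed infinitely often, a subsequence
missing the k-th union at step k would contradict the cs*-condition. *)
Lemma exists_cs_algebra : countable_cs_star_character_at e ->
  exists N, cs_algebra N.
Proof.
move=> [N0 cN0 N0P].
pose op (i : 'I_3) (A B : set X) : set X :=
  if val i is 0 then A `|` B else if val i is 1 then A **` B else A \\` B.
have [N [cN N0N Nop]] := countable_closure_ops op cN0.
exists N; split=> //.
- exact: (Nop (@Ordinal 3 0 isT)).
- exact: (Nop (@Ordinal 3 1 isT)).
- exact: (Nop (@Ordinal 3 2 isT)).
move=> O u eO ue; apply: contrapT => noA.
have [||Q QE] := @countable_enumeration _ (N0 `&` [set A | A `<=` O]).
- by apply: sub_countable cN0; apply: subset_card_le; exact: subIsetl.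
- by have [B [NB BO _]] := N0P O u eO ue; exists B.
have NQ k : N (cumulU Q k) /\ cumulU Q k `<=` O.
  have NQ i : N (Q i) /\ Q i `<=` O.
    by have [/N0N] : (N0 `&` [set A | A `<=` O]) (Q i) by rewrite -QE; exists i.
  elim: k => [|k [IH1 IH2]] /=; first exact: NQ.
  split; first by apply: (Nop (@Ordinal 3 0 isT)) => //; exact: (NQ _).1.
  by rewrite subUset; split=> //; exact: (NQ _).2.
have missed k : forall n, exists2 m, (n <= m)%N & ~ cumulU Q k (u m).
  by apply: not_eventually => ev; apply: noA; exists (cumulU Q k); case: (NQ k).
have /(_ _)/cid2-/all_sig2[g g_ge gP] := fun k => missed k k.
have goo : g @ \oo --> \oo.
  by apply/cvgnyPge => n; exists n => // m /= nm; exact: leq_trans nm (g_ge m).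
have [B [NB BO]] := N0P O (u \o g) eO (cvg_subseq goo ue).
have [i _ QB] : range Q B by rewrite QE.
apply; apply: sub_finite_set (finite_II i) => k /= Bk.
rewrite ltnNge; apply/negP => ik; apply: (gP k).
by apply: (cumulU_sup ik); rewrite QB.
Qed.

Context (N : set (set X)).
Hypothesis csN : cs_algebra N.

Definition small (O : set X) := N `&` [set A | A `<=` O].

Lemma small_cvg (O : set X) (u : nat -> X) : nbhs e O -> u @ \oo --> e ->
  exists2 A, small O A & \forall n \near \oo, A (u n).
Proof.
case: csN => _ _ _ _ cs eO ue; have [A [NA AO Au]] := cs O u eO ue.
by exists A.
Qed.

Lemma small_enumeration (O : set X) (P : set (set X)) : small O `&` P !=set0 ->
  exists Q : nat -> set X, range Q = small O `&` P.
Proof.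
case: csN => cN _ _ _ _ ne; apply: countable_enumeration => //.
apply: sub_countable cN; apply: subset_card_le.
by apply: subset_trans (@subIsetl _ _ _) (@subIsetl _ _ _).
Qed.

Lemma small_cumulU (O : set X) (Q : nat -> set X) n :
  (forall i, small O (Q i)) -> small O (cumulU Q n).
Proof.
case: csN => _ NU _ _ _ NQ; elim: n => [|n [N1 n1]] /=; first exact: NQ.
have [N2 n2] := NQ n.+1.
by split; [exact: NU|rewrite /= subUset].
Qed.

(** The quotients z \\ u j and u i \\ z tend to e, so they lie in small members
B and A of N; with u i in a small P, all u j with j large are in (P ** A) ** B.
The limit z itself need not be near e or belong to any member known in
advance. *)
Lemma small_trap (O : set X) : nbhs e O ->
  exists2 U : set X, nbhs e U & forall (u : nat -> X) (z : X),
    (forall j, exists2 P, small U P & P (u j)) -> u @ \oo --> z ->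
    exists2 A, small O A & \forall j \near \oo, A (u j).
Proof.
move=> /(near_mul_eee rX)[U eU UO]; exists U => // u z uP uz.
have [A [NA AU] [n _ /(_ _ (leqnn n)) /= An]] := small_cvg eU (cvg_ldivr rX uz).
have [B [NB BU] Bu] := small_cvg eU (cvg_ldivl rX uz).
have [P [NP PU] Pn] := uP n.
case: csN => _ _ NM _ _; exists ((P **` A) **` B).
  split; first by apply: (NM) => //; exact: NM.
  move=> _ [_ [p Pp [a Aa <-]] [b Bb <-]].
  by apply: UO; [exact: PU|exact: AU|exact: BU].
move: Bu; apply: filterS => j Bj; exists z.
  by exists (u n) => //; exists (u n \\ z) => //; rewrite (ldivK rX).
by exists (z \\ u j) => //; rewrite (ldivK rX).
Qed.

Definition barrier (B : set X) :=
  forall u : nat -> X, u @ \oo --> e -> \forall n \near \oo, B (u n).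

Lemma not_barrier_sequence (B O : set X) : nbhs e O -> ~ barrier B ->
  exists (u : nat -> X) (P : set X), [/\ u @ \oo --> e, small O P &
    forall n, P (u n) /\ ~ B (u n)].
Proof.
move=> eO /existsNP[u /not_implyP[ue /not_eventually nB]].
have [P NP [n0 _ Pu]] := small_cvg eO ue.
have [n|g goo gP] := @frequently_subsequence (fun n => P (u n) /\ ~ B (u n)).
  have [m] := nB (maxn n n0); rewrite geq_max => /andP[nm n0m] nBm.
  by exists m => //; split=> //; exact: Pu.
by exists (u \o g), P; split=> //; exact: cvg_subseq.
Qed.

(** The new term z m, adherent to y m, avoids those sets
closure ((z i ** A) ** B) that miss y m, where i < m and A, B are among the
first m members of N.  If a subsequence of z converged to p, every neighbourhood
of p would contain a set of this form holding almost all its terms, hence almost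
all the corresponding terms of y, and y would converge to p along that
subsequence. *)
Lemma perturb_divergent (y : nat -> X) (S : nat -> set X) :
  regular_space X -> divergent y -> (forall m, closure (S m) (y m)) ->
  exists2 z : nat -> X, (forall m, S m (z m)) & divergent z.
Proof.
move=> reg dy Sy.
have eT : nbhs e setT by exact: filterT.
have [|E EE] := @small_enumeration setT setT.
  have [A ? _] := small_cvg eT (@cvg_cst _ e nat \oo _).
  by exists A.
pose C p k l := closure (([set p] **` E k) **` E l).
pose P s x := S (size s) x /\ forall i k l : 'I_(size s),
  ~ C (nth e s i) k l (y (size s)) -> ~ C (nth e s i) k l x.
have [s|z zP] := @choice_with_history _ P.
  set m := size s.
  suff : nbhs (y m) [set x | forall i k l : 'I_m,
      ~ C (nth e s i) k l (y m) -> ~ C (nth e s i) k l x].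
    by move=> /(Sy m)[x [Sx hx]]; exists x.
  apply: filter_forall => i; apply: filter_forall => k; apply: filter_forall => l.
  have [h|h] := pselect (C (nth e s i) k l (y m)).
    by apply: filterS filterT => w _ /(_ h).
  have : nbhs (y m) (~` C (nth e s i) k l).
    apply: open_nbhs_nbhs; split=> //; apply: closed_openC; exact: closed_closure.
  by apply: filterS.
exists z => [m|g p goo zp]; first by have [] := zP m; rewrite size_mkseq.
apply: (dy g p) => // V pV.
have [V1 [pV1 cV1 V1V]] := regular_closed_nbhs reg pV.
have [A0 pA0 [W0 eW0 h0]] := near_mul_e rX pV1.
have [A1 pA1 [W1 eW1 h1]] := near_mul_e rX pA0.
have eW : nbhs e (W0 `&` W1) by exact: filterI.
have [A [NA AW] Aev] := small_cvg eW (cvg_ldivr rX zp).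
have [B [NB BW] Bev] := small_cvg eW (cvg_ldivl rX zp).
have [k _ Ek] : range E A by rewrite EE.
have [l _ El] : range E B by rewrite EE.
have [j0 _ h] : \forall j \near \oo, A1 (z (g j)) /\ A (z (g j) \\ p).
  by apply: filterI => //; exact: zp.
have {h} /= [A1q Aq] := h j0 (leqnn _).
set q := z (g j0) in A1q Aq.
have CV : C q k l `<=` V1.
  rewrite [V1 in _ `<=` V1](closure_id V1).1 //; apply: closureS.
  move=> _ [_ [_ -> [a Aa <-]] [b Bb <-]]; rewrite Ek in Aa; rewrite El in Bb.
  by apply: h0; [apply: h1 => //; exact: (AW a Aa).2|exact: (BW b Bb).1].
have Cz : \forall j \near \oo, C q k l (z (g j)).
  move: Bev; apply: filterS => j Bj; apply: subset_closure.
  exists p; last by exists (p \\ z (g j)); [rewrite El|exact: (ldivK rX)].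
  by exists q => //; exists (q \\ p); [rewrite Ek|exact: (ldivK rX)].
have gbig : \forall j \near \oo, (maxn (g j0) (maxn k l) < g j)%N.
  exact: (cvgnyPgt _).1 goo _.
suff : \forall j \near \oo, V (y (g j)) by [].
near=> j; apply/V1V/CV; apply: contrapT => nCy.
have : C q k l (z (g j)) by near: j.
have : (maxn (g j0) (maxn k l) < g j)%N by near: j.
rewrite !gtn_max => /and3P[ij kj lj].
have [_] := zP (g j); rewrite size_mkseq.
by move=> /(_ (Ordinal ij) (Ordinal kj) (Ordinal lj)) /=; rewrite nth_mkseq // => /(_ nCy).
Unshelve. all: by end_near. Qed.

End networks.

(** * Small members of the network when there are no small barriers *)

Section dichotomy.
Context (X : topologicalType) (e : X) (mul ldiv : X -> X -> X).
Hypothesis rX : rectification e mul ldiv.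

Local Notation "x ** y" := (mul x y) (at level 40, left associativity).
Local Notation "x \\ y" := (ldiv x y) (at level 40, left associativity).
Local Notation "A **` B" := [set a ** b | a in A & b in B]
  (at level 40, left associativity).
Local Notation "A \\` B" := [set a \\ b | a in A & b in B]
  (at level 40, left associativity).

Context (N : set (set X)).
Hypothesis csN : cs_algebra e mul ldiv N.
Hypothesis T3X : T3_space X.
Hypothesis sX : sequential_space X.

Let hX : hausdorff_space X := T3_hausdorff T3X.
Let regX : regular_space X := T3X.2.

Definition rel_seq_compact (A : set X) :=
  forall u : nat -> X, (forall n, A (u n)) -> ~ divergent u.

Lemma seq_compact_closure (A : set X) :
  rel_seq_compact A -> seq_compact (closure A).
Proof.
move=> rA u Au.
have [du|] := pselect (divergent u).
  by have [z Az dz] := perturb_divergent rX csN regX du Au; have := rA z Az.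
move=> /existsNP[g /existsNP[x /not_implyP[goo /contrapT ux]]].
exists g, x; split=> //; apply: closed_seq_cvg ux _; first exact: closed_closure.
by apply: nearW => n; exact: Au.
Qed.

(** Suppose arbitrarily small sets row n in N carry divergent sequences y n.
The points z n m are of the form y n m ** x n i, where x n tends to e
outside the quotients row n \\ Q l with l at most n; the index i is at least m
and is provided by perturb_divergent, so that z n is divergent for each n.
A sequence of such points with n unbounded cannot converge either: by the trap
its terms would eventually lie in one Q l, and x n i = y n m \\ z n m would lie in
row n \\ Q l.  Yet e is adherent to the set of all z n m. *)
Lemma no_barrier_rel_seq_compact (O : set X) :
  nbhs e O -> (forall A, small N O A -> ~ barrier e A) ->
  exists2 U : set X, nbhs e U & forall A, small N U A -> rel_seq_compact A.
Proof.
move=> eO nobar; apply: contrapT => noU.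
have [U1 eU1 U1O] := near_ldiv_e rX eO.
have [U2 eU2 trap] := small_trap rX csN eU1.
have [U3 [eU3 U3U1 U3U2]] : exists U3 : set X, [/\ nbhs e U3, U3 `<=` U1 &
    forall a b, U3 a -> U3 b -> U2 (a ** b)].
  have [V eV VU2] := near_mul_ee rX eU2; exists (V `&` U1); split=> [||a b [Va _] [Vb _]].
  - exact: filterI.
  - exact: subIsetr.
  - exact: VU2.
have {}noU U : nbhs e U -> exists A, (small N U `&` [set A | ~ rel_seq_compact A]) A.
  move=> eU; apply: contrapT => noA; apply: noU; exists U => // A NA.
  by apply: contrapT => rA; apply: noA; exists A.
have [row rowE] := small_enumeration csN (noU _ eU3).
have rowP n : small N U3 (row n) /\ ~ rel_seq_compact (row n).
  by have : range row (row n) by [exists n]; rewrite rowE.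
have /choice[y yP] n : exists y, (forall m, row n (y m)) /\ divergent y.
  have [_ /existsNP[y /not_implyP[ry /contrapT dy]]] := rowP n.
  by exists y.
have [|Q QE] := @small_enumeration _ _ _ _ _ csN U1 setT.
  have [A NA _] := small_cvg csN eU1 (@cvg_cst _ e nat \oo _).
  by exists A.
have QP l : small N U1 (Q l).
  by have : range Q (Q l) by [exists l]; rewrite QE => -[].
pose B n := cumulU (fun l => row n \\` Q l) n.
have NB n : small N O (B n).
  apply: (small_cumulU csN) => l; have [NQ QU1] := QP l.
  have [[Nr rU3] _] := rowP n; case: csN => _ _ _ Nd _; split; first exact: Nd.
  by move=> _ [a /rU3/U3U1 Oa [b /QU1 Ob <-]]; exact: U1O.
have /choice[x xP] n : exists x, exists2 P, small N U3 P &
    x @ \oo --> e /\ forall i, P (x i) /\ ~ B n (x i).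
  have [x [P [xe NP PB]]] := not_barrier_sequence csN eU3 (nobar _ (NB n)).
  by exists x, P.
have x_e n : x n @ \oo --> e by have [P _ []] := xP n.
pose S n m := [set y n m ** x n i | i in [set i | m <= i]].
have /choice[z zP] n : exists z, (forall m, S n m (z m)) /\ divergent z.
  have [z Sz dz] : exists2 z, (forall m, S n m (z m)) & divergent z.
    apply: (perturb_divergent rX csN regX) (yP n).2 _ => m V yV.
    have [W eW yWV] := near_mull rX yV.
    have : \forall i \near \oo, W (x n i) /\ (m <= i)%N.
      by apply: filterI; [exact: x_e|exact: nbhs_infty_ge].
    move=> [i _ /(_ i (leqnn i))[/= Wi mi]]; exists (y n m ** x n i).
    by split; [exists i|exact: yWV].
  by exists z.
pose A := [set p | p <> e /\ exists n m, p = z n m].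
have clA : closed A.
  apply: (sequentially_closed sX) => u p uA up.
  have /choice[nm nmE] j : exists nm : nat * nat, u j = z nm.1 nm.2.
    by have [_ [n [m ->]]] := uA j; exists (n, m).
  have /choice[i iP] j : exists i, u j = y (nm j).1 (nm j).2 ** x (nm j).1 i.
    by have [[i _ zE] _] := ((zP (nm j).1).1 (nm j).2, I); rewrite nmE -zE; exists i.
  have [noo|[n [h [hoo hn]]]] := cvgny_or_constant_subsequence (fst \o nm).
    exfalso; have [j|C NC] := trap u p _ up.
      have [[Nr rU3] _] := rowP (nm j).1.
      have [P [NP PU3] [_ PB]] := xP (nm j).1.
      case: csN => _ _ Nm _ _; exists (row (nm j).1 **` P).
        split; first exact: Nm.
        by move=> _ [a /rU3 Oa [b /PU3 Ob <-]]; exact: U3U2.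
      rewrite iP; exists (y (nm j).1 (nm j).2); first exact: (yP _).1.
      by exists (x (nm j).1 (i j)) => //; exact: (PB _).1.
    have [l _ lC] : range Q C by rewrite QE.
    move=> uC; have : \forall j \near \oo, C (u j) /\ (l <= (nm j).1)%N.
      by apply: filterI => //; exact: (cvgnyPge _).1 noo l.
    move=> [j _ /(_ j (leqnn j))[/= Cu lj]].
    have [P _ [_ /(_ (i j))[_]]] := xP (nm j).1; apply.
    apply: (cumulU_sup lj); rewrite lC.
    exists (y (nm j).1 (nm j).2); first exact: (yP _).1.
    by exists (u j) => //; rewrite iP (mulK rX).
  have [moo|[m [k [koo km]]]] := cvgny_or_constant_subsequence (snd \o nm \o h).
    exfalso; apply: ((zP n).2 _ p moo).
    rewrite (_ : _ \o _ = u \o h); first exact: cvg_subseq.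
    by apply/funext => j /=; rewrite nmE -(hn j).
  have cz : (fun=> z n m) @ \oo --> p.
    rewrite (_ : (fun=> _) = u \o h \o k); first by do 2?apply: cvg_subseq.
    by apply/funext => j /=; rewrite nmE -(km j) /= -(hn (k j)).
  have <- : z n m = p by apply: seq_cvg_unique hX _ cz; exact: cvg_cst.
  by have := uA (h (k 0)); rewrite nmE -(hn (k 0)) -(km 0).
have : ~ A e by case.
apply; rewrite (closure_id A).1 // => V eV.
have [W eW WV] := near_mul_ee rX eV.
have [D [[ND DW] rD]] := noU _ (filterI eW eU3).
have [n _ nD] : range row D by rewrite rowE; split=> //; split=> // a /DW[].
have [i0 _ xW] := x_e n _ eW.
have zV m : (i0 <= m)%N -> V (z n m).
  move=> i0m; have [i /= mi <-] := (zP n).1 m; apply: WV.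
    by have := (yP n).1 m; rewrite nD => /DW[].
  exact/xW/(leq_trans i0m mi).
have [m i0m zme] : exists2 m, (i0 <= m)%N & z n m <> e.
  apply: contrapT => noz; apply: ((zP n).2 (addn i0) e).
    exact: cvg_addnl.
  rewrite (_ : _ \o _ = fun=> e); first exact: cvg_cst.
  apply/funext => m /=; apply: contrapT => zne; apply: noz.
  by exists (i0 + m) => //; exact: leq_addr.
by exists (z n m); split; [split=> //; exists n, m|exact: zV].
Qed.
End dichotomy.

(** * Sequentially compact subsets *)

(** Sequential compactness makes the uniformity totally bounded, so an
ultrafilter contains some D k (p k) for each k; it converges to the limit of any
convergent subsequence of p. *)
Lemma compact_uniform_base (Z : topologicalType) (D : nat -> Z -> Z -> Prop) :
  uniform_base D ->
  (forall x (V : set Z), nbhs x V <-> exists k, D k x `<=` V) ->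
  seq_compact [set: Z] -> compact [set: Z].
Proof.
move=> UD DP cZ; rewrite compact_ultra => F UF _.
have [_ Dsym _ Dsplit _] := UD.
have cvgD (u : nat -> Z) c k : u @ \oo --> c -> \forall n \near \oo, D k c (u n).
  by move=> uc; apply: (uc (D k c)); apply/DP; exists k.
(* Otherwise some sequence has no two terms related by D k. *)
have tot k : exists s : seq Z, forall z, exists2 p, p \in s & D k p z.
  apply: contrapT => /forallNP nos.
  have [s|z zP] := @choice_with_history Z (fun s z => forall p, p \in s -> ~ D k p z).
    have /existsNP[z zs] := nos s; exists z => p ps Dpz.
    by apply: zs; exists p.
  have [g [c [goo _ zc]]] := cZ z (fun=> I).
  have [m mk] := Dsplit k.
  have [i0 _ zD] := cvgD _ c m zc.
  have : \forall j \near \oo, (g i0 < g j)%N /\ (i0 <= j)%N.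
    by apply: filterI; [exact: (cvgnyPgt _).1 goo _|exact: nbhs_infty_ge].
  move=> [j _ /(_ j (leqnn j))[/= ij i0j]].
  apply: (zP (g j) (z (g i0))).
    by apply: map_f; rewrite mem_iota add0n ij.
  by apply: (mk _ c); [apply: Dsym; exact: (zD i0 (leqnn i0))|exact: (zD j i0j)].
have FD k : exists p, F (D k p).
  have [s sP] := tot k.
  apply: contrapT => /forallNP noF.
  have : F [set z | forall p, p \in s -> ~ D k p z].
    elim: s {sP} => [|p s IH]; first by apply: filterS filterT.
    have Fp : F (~` D k p) by have [/noF|] := in_ultra_setVsetC (D k p) UF.
    apply: filterS (filterI IH Fp) => z [h1 h2] q.
    by rewrite inE => /predU1P[->|/h1].
  move=> /filter_ex[z zs]; have [p ps Dpz] := sP z.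
  exact: zs ps Dpz.
have /choice[p pF] := FD.
have [g [c [goo _ pc]]] := cZ p (fun=> I).
exists c; split=> // V /DP[k kV].
have [m mk] := Dsplit k.
have : \forall j \near \oo, D m c (p (g j)) /\ (m <= g j)%N.
  by apply: filterI; [exact: cvgD pc|exact: (cvgnyPge _).1 goo _].
move=> [j _ /(_ j (leqnn j))[/= Dcp mj]].
apply: filterS (pF (g j)) => z pz; apply/kV/(mk _ (p (g j))) => //.
exact: uniform_base_le UD mj pz.
Qed.

Section seq_compact_image.
Context (X : topologicalType) (e : X) (mul ldiv : X -> X -> X).
Hypothesis rX : rectification e mul ldiv.

Local Notation "x ** y" := (mul x y) (at level 40, left associativity).
Local Notation "x \\ y" := (ldiv x y) (at level 40, left associativity).

Context (N : set (set X)).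
Hypothesis csN : cs_algebra e mul ldiv N.
Hypothesis T3X : T3_space X.
Hypothesis sX : sequential_space X.

(** The subset is presented as an embedding f of a space Z, so that the results
apply to subspaces of subspaces of X. *)
Context (Z : topologicalType) (f : Z -> X).
Hypothesis f_inj : injective f.
Hypothesis f_init : forall z (V : set Z),
  nbhs z V <-> exists2 O, nbhs (f z) O & f @^-1` O `<=` V.
Hypothesis f_cpt : seq_compact (range f).

Let hX : hausdorff_space X := T3_hausdorff T3X.

Let f_cont : continuous f.
Proof. by move=> z V fV; apply/f_init; exists V. Qed.

Let f_lim (u : nat -> Z) z : u @ \oo --> z -> (fun n => f (u n)) @ \oo --> f z.
Proof. by move=> uz; apply: continuous_cvg => //; exact: f_cont. Qed.

Let f_cvg (u : nat -> Z) z : f \o u @ \oo --> f z -> u @ \oo --> z.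
Proof.
move=> fu V /f_init[W fW WV].
suff : \forall n \near \oo, V (u n) by [].
have : \forall n \near \oo, W (f (u n)) by exact: fu W fW.
by apply: filterS => n; exact: WV.
Qed.

Let Z_cpt : seq_compact [set: Z].
Proof.
move=> u _; have [n|g [x [goo [z _ <-] fu]]] := f_cpt (u := f \o u).
  by exists (u n).
by exists g, z; split=> //; exact: f_cvg.
Qed.

Let Z_seq_open (W : set Z) :
  (forall u z, W z -> u @ \oo --> z -> \forall n \near \oo, W (u n)) -> open W.
Proof.
move=> oW; have clZ := seq_compact_closed hX sX f_cpt.
have clW : closed (f @` ~` W).
  apply: (sequentially_closed sX) => u x fWu ux.
  have [z _ fzx] : range f x.
    apply: closed_seq_cvg clZ ux _; apply: nearW => n.
    by have [z _ <-] := fWu n; exists z.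
  have /choice[v vP] n : exists v, ~ W v /\ f v = u n.
    by have [v nWv <-] := fWu n; exists v.
  exists z => // Wz; have [|n _ /(_ n (leqnn n))] := oW v z Wz.
    apply: f_cvg; rewrite fzx (_ : f \o v = u) //.
    by apply/funext => n; case: (vP n).
  by case: (vP n).
have -> : W = f @^-1` (~` (f @` ~` W)).
  apply/seteqP; split=> [z Wz [w nWw /f_inj wz]|z nz].
    by apply: nWw; rewrite wz.
  by apply: contrapT => nWz; apply: nz; exists z.
by apply: open_comp; [move=> z _; exact: f_cont|exact: closed_openC].
Qed.

(** The analogue for the diagonal of Z of a barrier at e. *)
Let dbarrier (A : set X) := forall (u v : nat -> Z) (z : Z),
  u @ \oo --> z -> v @ \oo --> z -> \forall n \near \oo, A (f (u n) \\ f (v n)).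

(** Otherwise there are pairs of points of Z whose quotients lie in small members
of N and avoid more and more of the members inside O; along a subsequence both
points converge, hence also their quotient, which contradicts the trap. *)
Let small_dbarrier (O : set X) : nbhs e O -> (small N O `&` dbarrier) !=set0.
Proof.
move=> eO; apply: contrapT => nobar.
have [U eU trap] := small_trap rX csN eO.
have [|Q QE] := @small_enumeration _ _ _ _ _ csN O setT.
  have [A NA _] := small_cvg csN eO (@cvg_cst _ e nat \oo _).
  by exists A.
have QP l : small N O (Q l).
  by have : range Q (Q l) by [exists l]; rewrite QE => -[].
have /choice[ab abP] k : exists ab : Z * Z,
    (exists2 P, small N U P & P (f ab.1 \\ f ab.2)) /\
    ~ cumulU Q k (f ab.1 \\ f ab.2).
  have nb : ~ dbarrier (cumulU Q k).
    move=> db; apply: nobar; exists (cumulU Q k); split=> //.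
    exact: (small_cumulU csN).
  move: nb => /existsNP[u /existsNP[v /existsNP[z]]].
  move=> /not_implyP[uz /not_implyP[vz /not_eventually nB]].
  have te : (fun n => f (u n) \\ f (v n)) @ \oo --> e.
    by rewrite -(ldivxx rX (f z)); apply: (cvg_ldiv rX); exact: f_lim.
  have [P NP [n0 _ Pt]] := small_cvg csN eU te.
  have [m n0m nBm] := nB n0.
  by exists (u m, v m); split=> //; exists P => //; exact: Pt.
have [g [a [goo _ ga]]] := Z_cpt (u := fst \o ab) (fun=> I).
have [h [b [hoo _ gb]]] := Z_cpt (u := snd \o ab \o g) (fun=> I).
have tz : (fun n => f (ab (g (h n))).1 \\ f (ab (g (h n))).2) @ \oo --> f a \\ f b.
  by apply: (cvg_ldiv rX); apply: f_lim => //; exact: (cvg_subseq hoo ga).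
have [j|C NC Ct] := trap _ _ _ tz; first by case: (abP (g (h j))).
have [l _ lC] : range Q C by rewrite QE.
have ghoo : g \o h @ \oo --> \oo by exact: cvg_comp hoo goo.
have : \forall j \near \oo, C (f (ab (g (h j))).1 \\ f (ab (g (h j))).2) /\ (l <= g (h j))%N.
  by apply: filterI => //; exact: (cvgnyPge _).1 ghoo _.
move=> [j _ /(_ j (leqnn j))[/= Cj lj]].
by have [_] := abP (g (h j)); apply; apply: (cumulU_sup lj); rewrite lC.
Qed.

(** The base consists of the pairs whose two quotients lie in the first k
sets with the barrier property along the diagonal.  By sequential compactness a
failure of the composition axiom would occur at points converging to a common
limit, where that property excludes it. *)
Lemma seq_compact_uniform_base : exists D : nat -> Z -> Z -> Prop,
  uniform_base D /\
  (forall x (V : set Z), nbhs x V <-> exists k, D k x `<=` V).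
Proof.
have [|B BE] := @small_enumeration _ _ _ _ _ csN setT dbarrier.
  by apply: small_dbarrier; exact: filterT.
have Bbar i : dbarrier (B i).
  by have : range B (B i) by [exists i]; rewrite BE => -[].
have Bsmall (O : set X) : nbhs e O -> exists i, B i `<=` O.
  move=> /small_dbarrier[A [[NA AO] bA]].
  by have [i _ iA] : range B A; [rewrite BE|exists i; rewrite iA].
pose D k x y := forall i : 'I_k.+1, B i (f x \\ f y) /\ B i (f y \\ f x).
have Dxx k x : D k x x.
  move=> i; suff : B i (f x \\ f x) by [].
  by have [n _ /(_ n (leqnn n))] := Bbar i _ _ x (cvg_cst _) (cvg_cst _).
have Dsym k x y : D k x y -> D k y x by move=> xy i; case: (xy i).
have Dle k m x y : (k <= m)%N -> D m x y -> D k x y.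
  by move=> km xy i; exact: (xy (widen_ord (km : k < m.+1) i)).
have Dcvg k (u v : nat -> Z) (c : Z) : u @ \oo --> c -> v @ \oo --> c ->
    \forall n \near \oo, D k (u n) (v n).
  move=> uc vc; apply: filter_forall => i.
  exact: (filterI (Bbar i u v c uc vc) (Bbar i v u c vc uc)).
have Dsplit k : exists m, forall x y z, D m x y -> D m y z -> D k x z.
  apply: contrapT => /forallNP noS.
  have /choice[t tP] m : exists t : Z * Z * Z,
      [/\ D m t.1.1 t.1.2, D m t.1.2 t.2 & ~ D k t.1.1 t.2].
    have /existsNP[x /existsNP[y /existsNP[z]]] := noS m.
    by move=> /not_implyP[xy /not_implyP[yz xz]]; exists (x, y, z).
  have [g [c [goo _ gc]]] := Z_cpt (u := fun m => (t m).1.1) (fun=> I).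
  have step (u v : nat -> Z) : u @ \oo --> c ->
      (forall j, D (g j) (u j) (v j)) -> v @ \oo --> c.
    move=> uc uv; apply: f_cvg.
    have -> : f \o v = (fun j => f (u j) ** (f (u j) \\ f (v j))).
      by apply/funext => j; rewrite /= (ldivK rX).
    rewrite -(mule rX (f c)); apply: (cvg_mul rX).
      exact: f_lim.
    move=> O eO; have [i iO] := Bsmall O eO.
    suff : \forall j \near \oo, O (f (u j) \\ f (v j)) by [].
    have : \forall j \near \oo, (i <= g j)%N by exact: (cvgnyPge _).1 goo i.
    apply: filterS => j ij.
    exact/iO/(uv j (Ordinal (ij : i < (g j).+1))).1.
  have gy : (fun j => (t (g j)).1.2) @ \oo --> c.
    by apply: step gc _ => j; case: (tP (g j)).
  have gz : (fun j => (t (g j)).2) @ \oo --> c.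
    by apply: step gy _ => j; case: (tP (g j)).
  have [n _ /(_ n (leqnn n))] := Dcvg k _ _ _ gc gz.
  by case: (tP (g n)).
exists D; split; first split=> //.
- by move=> k x y; exact: Dle.
- move=> x y xy; apply: f_inj; apply: contrapT => fxy.
  have /eqP/(T3X.1 _ _)[A [oA]] : e <> f x \\ f y.
    by move=> exy; apply: fxy; rewrite -[f x](mule rX) exy (ldivK rX).
  rewrite !inE => Ae; apply.
  have [i iA] := Bsmall A (open_nbhs_nbhs (conj oA Ae)).
  exact/iA/(xy i ord_max).1.
- move=> x V; split=> [/f_init[W xW WV]|[k kV]].
    have [A eA AW] := near_mull rX xW; have [i iA] := Bsmall A eA.
    exists i => y xy; apply: WV => /=; rewrite -[f y](ldivK rX (f x)).
    exact/AW/iA/(xy ord_max).1.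
  apply: (filterS kV); pose W := [set y | exists m, D m y `<=` D k x].
  apply: (@filterS _ _ _ W); first by move=> y [m my]; exact/my/Dxx.
  apply: open_nbhs_nbhs; split; last by exists k.
  apply: Z_seq_open => u y [m my] uy; have [l lm] := Dsplit m.
  have : \forall n \near \oo, D l y (u n) by exact: Dcvg (cvg_cst y) uy.
  apply: filterS => n yu.
  by exists l => w uw; apply/my/(lm _ (u n)).
Qed.

Lemma seq_compact_metrizable (R : realType) : metrizable R Z.
Proof.
have [D [UD DP]] := seq_compact_uniform_base.
exact: metrizable_uniform_base UD DP.
Qed.

Lemma seq_compact_compact : compact [set: Z].
Proof.
have [D [UD DP]] := seq_compact_uniform_base.
exact: compact_uniform_base UD DP Z_cpt.
Qed.

End seq_compact_image.

(** * Small barriers make the space metrizable *)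

Section metrizable_case.
Context (X : topologicalType) (e : X) (mul ldiv : X -> X -> X).
Hypothesis rX : rectification e mul ldiv.

Local Notation "x ** y" := (mul x y) (at level 40, left associativity).
Local Notation "x \\ y" := (ldiv x y) (at level 40, left associativity).

Context (N : set (set X)).
Hypothesis csN : cs_algebra e mul ldiv N.
Hypothesis T3X : T3_space X.
Hypothesis sX : sequential_space X.

(** The intersections C k of initial segments of the list of barriers of N shrink
to e, so that a relation which holds eventually along all sequences tending to e
holds on some C m.  This shows first that the points x with x ** C m inside C k for some m form an open set, so that C k is a
neighbourhood of e, and then Frink's condition for the neighbourhoods U n x,
symmetrized because y cannot be recovered from y ** b and b. *)
Lemma barriers_metrizable (R : realType) :
  (forall O : set X, nbhs e O -> exists2 A, small N O A & barrier e A) ->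
  metrizable R X.
Proof.
move=> bar.
have [|Q QE] := @small_enumeration _ _ _ _ _ csN setT (barrier e).
  by have [A NA bA] := bar setT filterT; exists A.
pose C k := [set x | forall i : 'I_k.+1, Q i x].
have Cbar k : barrier e (C k).
  move=> u ue; apply: filter_forall => i.
  have : range Q (Q i) by exists i.
  by rewrite QE => -[_ /(_ u ue)].
have Cle k m : (k <= m)%N -> C m `<=` C k.
  by move=> km x Cx i; exact: (Cx (widen_ord (km : k < m.+1) i)).
have Csmall (O : set X) : nbhs e O -> exists k, C k `<=` O.
  move=> /bar[A [NA AO] bA]; have [k _ kA] : range Q A by rewrite QE.
  by exists k => x /(_ ord_max) /=; rewrite kA; exact: AO.
have Ce k : C k e by have [n _ /(_ n (leqnn n))] := Cbar k _ (cvg_cst e).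
have Ccvg (a : nat -> X) : (forall m, C m (a m)) -> a @ \oo --> e.
  move=> Ca O /Csmall[k kO]; exists k => // m /= km.
  exact/kO/(Cle _ _ km).
have Cunif (P : X -> X -> X -> Prop) :
    (forall a b c : nat -> X, a @ \oo --> e -> b @ \oo --> e -> c @ \oo --> e ->
      \forall n \near \oo, P (a n) (b n) (c n)) ->
    exists m, forall a b c, C m a -> C m b -> C m c -> P a b c.
  move=> Pseq; apply: contrapT => /forallNP noP.
  have /choice[t tP] m : exists t : X * X * X,
      [/\ C m t.1.1, C m t.1.2, C m t.2 & ~ P t.1.1 t.1.2 t.2].
    have /existsNP[a /existsNP[b /existsNP[c]]] := noP m.
    by move=> /not_implyP[Ca /not_implyP[Cb /not_implyP[Cc nP]]]; exists (a, b, c).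
  have [] := Pseq (fun m => (t m).1.1) (fun m => (t m).1.2) (fun m => (t m).2).
  - by apply: Ccvg => m; case: (tP m).
  - by apply: Ccvg => m; case: (tP m).
  - by apply: Ccvg => m; case: (tP m).
  - by move=> n _ /(_ n (leqnn n)); case: (tP n).
have Cnbhs k : nbhs e (C k).
  pose W := [set x | exists m, forall b, C m b -> C k (x ** b)].
  apply: (@filterS _ _ _ W).
    by move=> x [m mk]; rewrite -[x](mule rX); exact: mk.
  apply: open_nbhs_nbhs; split; last first.
    have [|m mP] := @Cunif (fun a _ _ => C k (e ** a)).
      move=> a _ _ ae _ _; apply: (Cbar k (fun n => e ** a n)).
      by rewrite -{2}(mule rX e); apply: (cvg_mul rX) => //; exact: cvg_cst.
    by exists m => b Cb; exact: (mP b e e).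
  apply: (sequentially_open sX) => u x [m mk] ux.
  have [|l lP] := @Cunif (fun a b _ => C m (x \\ ((x ** a) ** b))).
    move=> a b _ ae be _; apply: (Cbar m (fun n => x \\ ((x ** a n) ** b n))).
    apply: (cvg_ldivl rX); rewrite -{2}(mule rX x); apply: (cvg_mul rX) be.
    by rewrite -{2}(mule rX x); apply: (cvg_mul rX) ae; exact: cvg_cst.
  have : \forall n \near \oo, C l (x \\ u n) by exact: Cbar (cvg_ldivl rX ux).
  apply: filterS => n Cl; exists l => b Cb.
  rewrite -[u n](ldivK rX x) -[_ ** b](ldivK rX x).
  exact/mk/(lP _ _ e).
pose U n x := [set z | C n (x \\ z) /\ C n (z \\ x)].
have Unbhs n x : nbhs x (U n x).
  apply: filterI.
    have h : (fun z => x \\ z) @ x --> e; last exact: (h _ (Cnbhs n)).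
    by rewrite -(ldivxx rX x); apply: (cvg_ldiv rX); [exact: cvg_cst|exact: cvg_id].
  have h : (fun z => z \\ x) @ x --> e; last exact: (h _ (Cnbhs n)).
  by rewrite -(ldivxx rX x); apply: (cvg_ldiv rX); [exact: cvg_id|exact: cvg_cst].
apply: (@metrizable_Frink R X U) => //.
- by move=> n x; exact: nbhs_singleton.
- by move=> n x z [h1 h2]; split; apply: Cle (leqnSn n) _ _.
- move=> x V; split=> [/(near_mull rX)[A eA AV]|[n nV]]; last exact: filterS nV _.
  have [n nA] := Csmall _ eA; exists n => z [/nA/AV].
  by rewrite (ldivK rX).
- move=> n x.
  have [|m mP] := @Cunif (fun a b c => U n x (((x ** a) ** b) ** c)).
    move=> a b c ae be ce.
    have h : (fun j => ((x ** a j) ** b j) ** c j) @ \oo --> x.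
      rewrite -{2}(mule rX x); apply: (cvg_mul rX) ce.
      rewrite -{2}(mule rX x); apply: (cvg_mul rX) be.
      by rewrite -{2}(mule rX x); apply: (cvg_mul rX) ae; exact: cvg_cst.
    exact: (h _ (Unbhs n x)).
  exists m => y [w [[xw _] [_ wy]]] z [yz _].
  by have := mP _ _ _ xw wy yz; rewrite !(ldivK rX).
- exact: T3X.1.
Qed.

End metrizable_case.

(** * The clopen subspace *)

Section sub_rectifiable.
Context (X : topologicalType) (e : X) (mul ldiv : X -> X -> X).
Hypothesis rX : rectification e mul ldiv.

Lemma sub_rectifiable (Y : set X) : Y e ->
  (forall x y, Y x -> Y y -> Y (mul x y)) ->
  (forall x y, Y x -> Y y -> Y (ldiv x y)) -> rectifiable (set_type Y).
Proof.
move=> Ye Ym Yd.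
pose inY x (Yx : Y x) : set_type Y := SigSub (mem_set Yx).
pose m (a b : set_type Y) := inY _ (Ym _ _ (set_valP a) (set_valP b)).
pose d (a b : set_type Y) := inY _ (Yd _ _ (set_valP a) (set_valP b)).
apply: (@rectification_rectifiable (set_type Y) (inY _ Ye) m d).
have val_cont : continuous (set_val : set_type Y -> X) by exact: initial_continuous.
have v1 (p : set_type Y * set_type Y) : (fun q => set_val q.1) @ p --> set_val p.1.
  by apply: continuous_cvg; [exact: val_cont|exact: cvg_fst].
have v2 (p : set_type Y * set_type Y) : (fun q => set_val q.2) @ p --> set_val p.2.
  by apply: continuous_cvg; [exact: val_cont|exact: cvg_snd].
split.
- by move=> p; apply/cvg_set_val; have h := cvg_mul rX (v1 p) (v2 p); exact: h.
- by move=> p; apply/cvg_set_val; have h := cvg_ldiv rX (v1 p) (v2 p); exact: h.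
- by move=> a b; apply: val_inj; exact: ldivK rX _ _.
- by move=> a b; apply: val_inj; exact: mulK rX _ _.
- by move=> a; apply: val_inj; exact: mule rX _.
Qed.

End sub_rectifiable.

Section sk_omega_case.
Context (X : topologicalType) (e : X) (mul ldiv : X -> X -> X).
Hypothesis rX : rectification e mul ldiv.

Local Notation "x ** y" := (mul x y) (at level 40, left associativity).
Local Notation "x \\ y" := (ldiv x y) (at level 40, left associativity).

Context (N : set (set X)).
Hypothesis csN : cs_algebra e mul ldiv N.
Hypothesis T3X : T3_space X.
Hypothesis sX : sequential_space X.

Let hX : hausdorff_space X := T3_hausdorff T3X.

(** Y is the union of the countable family F generated by the closures of the
small members of N.  A sequence converging to a point x of Y is eventually in
the member K1 ** K2 of F, where x is in K1 and K2 contains almost all x \\ u n.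
This makes Y open and the topology of Y determined by F; Y is closed by
x = u n ** (u n \\ x). *)
Lemma clopen_sk_omega (R : realType) (U : set X) :
  nbhs e U -> (forall A, small N U A -> rel_seq_compact A) ->
  exists A : set X,
    [/\ clopen A, rectifiable (set_type A) & sk_omega_space R (set_type A)].
Proof.
move=> eU rU.
pose op (b : bool) (K L : set X) : set X :=
  if b then [set x ** y | x in K & y in L] else [set x \\ y | x in K & y in L].
have [|F1 [cF1 F01 F1op]] := @countable_closure_ops _ _ op [set closure A | A in small N U].
  apply: sub_countable (card_image_le _ _) _.
  by case: csN => cN _ _ _ _; apply: sub_countable cN; apply: subset_card_le; exact: subIsetl.
pose F := F1 `&` [set K | seq_compact K].
have FM K L : F K -> F L -> F (op true K L).
  move=> [FK cK] [FL cL]; split; first exact: (F1op true).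
  exact: seq_compact_image2 (mul_continuous rX) cK cL.
have FD K L : F K -> F L -> F (op false K L).
  move=> [FK cK] [FL cL]; split; first exact: (F1op false).
  exact: seq_compact_image2 (ldiv_continuous rX) cK cL.
have Fcl K : F K -> closed K by case=> _; exact: seq_compact_closed.
have Floc (u : nat -> X) : u @ \oo --> e ->
    exists K, [/\ F K, K e & \forall n \near \oo, K (u n)].
  move=> ue; have [A NA Au] := small_cvg csN eU ue.
  have FA : F (closure A).
    split; first by apply: F01; exists A.
    by apply: (seq_compact_closure rX csN T3X); exact: rU.
  have Ku : \forall n \near \oo, closure A (u n).
    by move: Au; apply: filterS => n; exact: subset_closure.
  by exists (closure A); split=> //; exact: closed_seq_cvg (Fcl _ FA) ue Ku.
pose Y := \bigcup_(K in F) K.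
have Ym x y : Y x -> Y y -> Y (x ** y).
  move=> [K FK Kx] [L FL Ly]; exists (op true K L); first exact: FM.
  by exists x => //; exists y.
have Yd x y : Y x -> Y y -> Y (x \\ y).
  move=> [K FK Kx] [L FL Ly]; exists (op false K L); first exact: FD.
  by exists x => //; exists y.
have Ye : Y e by have [K [FK Ke _]] := Floc _ (cvg_cst e); exists K.
have oY : open Y.
  apply: (sequentially_open sX) => u x Yx ux.
  have [K [FK _]] := Floc _ (cvg_ldivl rX ux); apply: filterS => n Ku.
  by rewrite -(ldivK rX x (u n)); apply: Ym => //; exists K.
have clY : closed Y.
  apply: (sequentially_closed sX) => u x Yu ux.
  have [K [FK _ [n _ /(_ n (leqnn n)) /= Kn]]] := Floc _ (cvg_ldivr rX ux).
  by rewrite -(ldivK rX (u n) x); apply: Ym => //; exists K.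
exists Y; split; [by []|exact: (sub_rectifiable rX)|].
exists [set set_val @^-1` K | K in F]; split.
- apply: sub_countable (card_image_le _ _) _.
  by apply: sub_countable cF1; apply: subset_card_le; exact: subIsetl.
- move=> _ [K FK <-]; set C := set_val @^-1` K.
  pose f (z : set_type C) : X := set_val (set_val z).
  have f_inj : injective f by move=> a b ab; do 2!apply: val_inj.
  have f_init (z : set_type C) (V : set (set_type C)) :
      nbhs z V <-> exists2 W, nbhs (f z) W & f @^-1` W `<=` V.
    split=> [/nbhs_set_val[V1 /nbhs_set_val[W zW WV1] V1V]|[W zW WV]].
      by exists W => // y Wy; apply: V1V; exact: WV1.
    apply/nbhs_set_val; exists (set_val @^-1` W) => //.
    by apply/nbhs_set_val; exists W.
  have f_range : range f = K.
    apply/seteqP; split=> [_ [z _ <-]|x Kx]; first exact: (set_valP z).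
    have Yx : Y x by exists K.
    have Cx : C (SigSub (mem_set Yx)) by [].
    by exists (SigSub (mem_set Cx)).
  have f_cpt : seq_compact (range f) by rewrite f_range; case: FK.
  split; last exact: (seq_compact_metrizable rX csN T3X sX f_inj f_init f_cpt).
  have := seq_compact_compact rX csN T3X sX f_inj f_init f_cpt.
  have cval : {within [set: set_type C], continuous (set_val : set_type C -> set_type Y)}.
    by apply: continuous_subspaceT; exact: initial_continuous.
  move=> /(continuous_compact cval).
  rewrite (_ : _ @` _ = C) //; apply/seteqP; split=> [_ [z _ <-]|y Cy].
    exact: (set_valP z).
  by exists (SigSub (mem_set Cy)).
move=> G; split=> [cG _ [K FK <-]|cG].
  exact: closed_preimage_set_val.
have clG : closed (set_val @` G).
  apply: (sequentially_closed sX) => u x Gu ux.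
  have Yu n : Y (u n) by have [y _ <-] := Gu n; exact: (set_valP y).
  have Yx : Y x by apply: closed_seq_cvg clY ux _; exact: nearW.
  have [K1 FK1 K1x] := Yx.
  have [K2 [FK2 K2e K2u]] := Floc _ (cvg_ldivl rX ux).
  have FK := FM _ _ FK1 FK2; set K := op true K1 K2 in FK.
  pose C := (set_val @^-1` K : set (set_type Y)).
  have Kx : K x by exists x => //; exists e => //; exact: mule rX _.
  have [n0 _ Ku] : \forall n \near \oo, K (u n).
    move: K2u; apply: filterS => n K2n; exists x => //.
    by exists (x \\ u n) => //; exact: ldivK rX _ _.
  have {}Ku n : K (u (n0 + n)) by apply: Ku; rewrite /= leq_addr.
  pose inC y (Yy : Y y) (Ky : K y) : set_type C :=
    SigSub (mem_set (Ky : C (SigSub (mem_set Yy)))).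
  have vx : (fun n => inC _ (Yu (n0 + n)) (Ku n)) @ \oo --> inC _ Yx Kx.
    by do 2!apply/cvg_set_val; exact: cvg_subseq (cvg_addnl n0) ux.
  have clC := cG C (ex_intro2 _ _ K FK erefl).
  exists (SigSub (mem_set Yx)) => //.
  apply: (closed_seq_cvg clC vx); apply: nearW => n /=.
  have [y Gy yu] := Gu (n0 + n).
  by rewrite (_ : set_val _ = y) //; apply: val_inj; exact/esym/yu.
rewrite (_ : G = set_val @^-1` (set_val @` G)).
  exact: closed_preimage_set_val.
by apply/seteqP; split=> [y Gy|y [z Gz /val_inj <-]]; [exists y|].
Qed.

End sk_omega_case.

(** * Strong Pytkeev property of metrizable and of sk_omega-spaces *)

Lemma nbhs_small_ball (R : realType) (M : metricType R) (x : M) (V : set M) :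
  nbhs x V -> exists n : nat, forall q, ball q (n.+1%:R^-1 : R)%R x ->
    ball q (n.+1%:R^-1 : R)%R `<=` V.
Proof.
move=> /nbhs_ballP[r /= r0 rV].
have r20 : (0 < r / 2)%R by rewrite divr_gt0.
have [n _ /(_ n (leqnn n)) /= nr] := near_infty_natSinv_lt (PosNum r20).
exists n => q qx y qy; apply: rV.
rewrite (splitr r); apply: (ball_triangle (y := q)).
  by apply: ball_sym; apply: le_ball qx; exact: ltW.
by apply: le_ball qy; exact: ltW.
Qed.

Lemma metrizable_strong_Pytkeev (R : realType) (X : topologicalType) :
  metrizable R X -> strong_Pytkeev X.
Proof.
move=> [M [f [cf [g [fK gK cg]]]]] x.
pose B (n : nat) := f @^-1` (ball (f x) (n.+1%:R^-1 : R)%R).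
have xB n : nbhs x (B n) by apply: cf; exact: nbhsx_ballx.
exists (range B).
  by apply: sub_countable (card_image_le _ _) _; exact: countableP.
move=> W A xW Ax.
have : nbhs (f x) (g @^-1` W) by apply: cg; rewrite fK.
move=> /nbhs_small_ball[n nW]; exists (B n); split.
- by exists n.
- move=> y By; rewrite -(fK y); apply: nW By => /=; exact: ballxx.
- exact: Ax.
Qed.

Lemma strong_Pytkeev_at_open_embedding (X Y : topologicalType) (h : Y -> X) (a : Y) :
  injective h -> {for a, continuous h} ->
  (forall V : set Y, nbhs a V -> nbhs (h a) (h @` V)) ->
  strong_Pytkeev_at a -> strong_Pytkeev_at (h a).
Proof.
move=> ih ch oh [N cN NP]; exists [set h @` B | B in N].
  exact: sub_countable (card_image_le _ _) cN.
move=> W A aW Aa.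
have [||B [NB BW iB]] := NP (h @^-1` W) (h @^-1` A).
- exact: ch.
- move=> V /oh/Aa; apply: contra_not => fV.
  apply: sub_finite_set (finite_image h fV) => _ [[y Vy <-] Ahy].
  by exists y.
- exists (h @` B); split; first by exists B.
    by move=> _ [y By <-]; exact: BW.
  apply: contra_not iB => fB.
  apply: sub_finite_set (finite_preimage (in2W ih) fB).
  by move=> y [By Ay]; split=> //; exists y.
Qed.

(** A cluster point of the filter of sets containing all but finitely many
points of T. *)
Lemma infinite_compact_accumulation (X : topologicalType) (L T : set X) :
  compact L -> T `<=` L -> infinite_set T ->
  exists2 p, L p & accumulation_point T p.
Proof.
move=> cL TL iT; pose G : set_system X := [set A | finite_set (T `\` A)].
have GG : ProperFilter G.
  apply: Build_ProperFilter_ex.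
    move=> A; rewrite /G /= => fA; apply: contrapT => /forallNP noA; apply: iT.
    by apply: sub_finite_set fA => x Tx; split=> //; exact: noA.
  split.
  - by rewrite /G /= setDT; exact: finite_set0.
  - by move=> A B fA fB; rewrite /G /= setDIr finite_setU.
  - by move=> A B AB; apply: sub_finite_set; exact: setDS.
have [|p [Lp clp]] := cL G GG.
  by rewrite /G /= (_ : T `\` L = set0); [exact: finite_set0|rewrite setD_eq0].
exists p => // W pW fW.
have [||y [[_ nWy] Wy]] := clp (T `\` W) W => //.
by rewrite /G /= setDD setIC.
Qed.

Lemma compact_finite_subcover (X : topologicalType) (I : eqType) (W : I -> set X)
    (C : set X) :
  compact C -> (forall i, open (W i)) -> (forall x, C x -> exists i, W i x) ->
  exists s : seq I, forall x, C x -> exists2 i, i \in s & W i x.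
Proof.
move=> cC oW CW; apply: contrapT => /forallNP nos.
pose U (s : seq I) := [set x | exists2 i, i \in s & W i x].
pose G := filter_from [set: seq I] (fun s => C `\` U s).
have GG : ProperFilter G.
  apply: filter_from_proper; last first.
    by move=> s _; have /existsNP[x /not_implyP[Cx nx]] := nos s; exists x.
  apply: filter_from_filter; first by exists [::].
  move=> s t _ _; exists (s ++ t) => // x [Cx nx].
  by split; split=> // -[i si Wi]; apply: nx; exists i => //; rewrite mem_cat si ?orbT.
have [|x [Cx clx]] := cC G GG; first by exists [::] => // x [].
have [i Wi] := CW x Cx.
have [||y [[_ ny] Wy]] := clx (C `\` U [:: i]) (W i).
- by exists [:: i].
- exact: open_nbhs_nbhs.
- by apply: ny; exists i => //; rewrite inE.
Qed.

(** For each n, finitely many balls of radius 1/(n+1) cover C; the members of N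
are these balls, which are neighbourhoods of their points in C but not in X. *)
Lemma compact_metrizable_network (R : realType) (X : topologicalType) (C : set X) :
  compact C -> metrizable R (set_type C) ->
  exists2 N : set (set X), countable N &
    forall (p : X) (W : set X), C p -> nbhs p W ->
      exists B, [/\ N B, B `<=` W & exists2 V, nbhs p V & V `&` C `<=` B].
Proof.
move=> cC [M [f [cf [g [fK gK cg]]]]].
pose B (n : nat) (q : set_type C) : set X :=
  set_val @` (f @^-1` (ball (f q) (n.+1%:R^-1 : R)%R)).
have /choice[W WP] (nq : nat * set_type C) :
    exists W, [/\ open W, W (set_val nq.2) & W `&` C `<=` B nq.1 nq.2].
  case: nq => n q /=.
  have /nbhs_set_val[W] : nbhs q (f @^-1` (ball (f q) (n.+1%:R^-1 : R)%R)).
    by apply: cf; exact: nbhsx_ballx.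
  rewrite nbhsE => -[W1 [oW1 W1q] W1W] WB; exists W1; split=> // y [W1y Cy].
  by exists (SigSub (mem_set Cy)) => //; apply: WB; exact: W1W.
have /choice[D DP] n : exists D : seq (set_type C),
    forall x, C x -> exists2 q, q \in D & W (n, q) x.
  apply: compact_finite_subcover cC _ _ => [q|p Cp]; first by case: (WP (n, q)).
  by exists (SigSub (mem_set Cp)); case: (WP (n, SigSub (mem_set Cp))).
exists (\bigcup_n [set B n q | q in [set` D n]]).
  apply: bigcup_countable => // n _.
  by apply: sub_countable (card_image_le _ _) _; exact: finite_set_countable.
move=> p V Cp pV; pose p' : set_type C := SigSub (mem_set Cp).
have : nbhs (f p') (g @^-1` (set_val @^-1` V)).
  by apply: cg; rewrite fK; apply/nbhs_set_val; exists V.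
move=> /nbhs_small_ball[n nV]; have [q Dq Wp] := DP n p Cp.
have [oW _ WB] := WP (n, q).
have [z zq zp] := WB p (conj Wp Cp).
have zE : z = p' by apply: val_inj.
exists (B n q); split.
- by exists n => //; exists q.
- move=> _ [y yq <-]; rewrite -(fK y); apply: nV yq.
  by rewrite -zE.
- by exists (W (n, q)) => //; exact: open_nbhs_nbhs.
Qed.

Lemma accessible_subspace (X : topologicalType) (A : set X) :
  accessible_space X -> accessible_space (set_type A).
Proof.
move=> T1 x y xy; have /T1[V [oV Vx Vy]] : set_val x != set_val y.
  by apply: contra_neq xy => /val_inj.
exists (set_val @^-1` V); split; first by exists V.
- by move: Vx; rewrite !inE.
- by move: Vy; rewrite !inE.
Qed.

(** If S inside V met every piece in a finite set, S minus x would be closed in V,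
and S could not accumulate at x.  The point p at which the intersection of S,
V and C accumulates need not be x, but it is in V, hence has W as a neighbourhood. *)
Lemma sk_omega_strong_Pytkeev (R : realType) (Y : topologicalType) :
  accessible_space Y -> regular_space Y -> sk_omega_space R Y -> strong_Pytkeev Y.
Proof.
move=> T1 reg [K [cK KP closedP]] x.
have /choice[N NP] (C : set Y) : exists N : set (set Y), K C -> countable N /\
    forall (p : Y) (W : set Y), C p -> nbhs p W ->
      exists B, [/\ N B, B `<=` W & exists2 V, nbhs p V & V `&` C `<=` B].
  have [KC|nKC] := pselect (K C); last by exists set0.
  have [cC mC] := KP C KC; have [N] := compact_metrizable_network cC mC.
  by exists N.
exists (\bigcup_(C in K) N C).
  by apply: bigcup_countable => // C /NP[].
move=> W S xW Sx; have [V [xV cV VW]] := regular_closed_nbhs reg (nbhs_interior xW).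
have [C [KC iC]] : exists C, K C /\ infinite_set (S `&` V `&` C).
  apply: contrapT => noC.
  have cT : closed ((S `&` V) `\ x).
    apply/closedP => C KC; apply: (accessible_finite_set_closed.1 (accessible_subspace T1)).
    have fC : finite_set (S `&` V `&` C) by apply: contrapT => iC; apply: noC; exists C.
    apply: sub_finite_set (finite_preimage (in2W val_inj) fC) => z [SVz _].
    by split=> //; exact: set_valP.
  apply: (Sx (V `&` ~` ((S `&` V) `\ x))).
    apply: filterI => //; apply: open_nbhs_nbhs; split; first exact: closed_openC.
    by move=> [_]; apply.
  apply: sub_finite_set (finite_set1 x) => y [[Vy nSVy] Sy].
  by apply: contrapT => yx; apply: nSVy.
have [cC _] := KP C KC.
have cL : compact (C `&` V) by exact: compact_closedI.
have [|p [Cp Vp] acc] := infinite_compact_accumulation cL _ iC.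
  by move=> y [[_ Vy] Cy].
have [_ /(_ p W Cp (VW p Vp))[B [NB BW [U pU UB]]]] := NP C KC.
exists B; split=> //; first by exists C.
apply: sub_infinite_set (acc U pU) => y [Uy [[Sy _] Cy]].
by split=> //; exact: UB.
Qed.

Theorem theorem5p2 (R : realType) (X : topologicalType)
    (seqX : sequential_space X) (rectX : rectifiable X) :
  (kolmogorov_space X <-> T3_space X) /\
  (kolmogorov_space X ->
   [<-> strong_Pytkeev X;
        countable_cs_star_character X;
        metrizable R X \/
        exists A : set X,
          [/\ clopen A, rectifiable (set_type A) &
              sk_omega_space R (set_type A)]]).
Proof.
have [e [mul [ldiv rX]]] := rectifiable_rectification rectX.
split=> [|/(rectification_T3 rX) T3X]; first exact: rectification_T3 rX.
tfae.
- exact: strong_Pytkeev_cs_star T3X.1.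
- move=> /(_ e)/(exists_cs_algebra mul ldiv)[N csN].
  have [bar|] := pselect (forall O : set X, nbhs e O ->
      exists2 A, small N O A & barrier e A).
    by left; exact: (barriers_metrizable rX csN T3X seqX R bar).
  move=> /existsNP[W /not_implyP[eW /forall2NP nobar]]; right.
  have [|U eU rU] := no_barrier_rel_seq_compact rX csN T3X seqX eW.
    by move=> A NA; have [] := nobar A.
  exact: (clopen_sk_omega rX csN T3X seqX R eU rU).
- move=> [/metrizable_strong_Pytkeev//|[A [[oA _] rectA skA]]] x.
  have [eA [mulA [ldivA rA]]] := rectifiable_rectification rectA.
  have PA : strong_Pytkeev (set_type A).
    by apply: (sk_omega_strong_Pytkeev _ _ skA);
      [exact: accessible_subspace T3X.1|exact: rectification_regular rA].
  have PX : strong_Pytkeev_at (set_val eA).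
    apply: strong_Pytkeev_at_open_embedding (PA eA).
    - exact: val_inj.
    - exact: initial_continuous.
    - move=> V /nbhs_set_val[W eW WV].
      apply: filterS (filterI eW (open_nbhs_nbhs (conj oA (set_valP eA)))).
      by move=> y [Wy Ay]; exists (SigSub (mem_set Ay)) => //; exact: WV.
  have [h [ch [g [hK gK cg]]] <-] := homogeneous rX (set_val eA) x.
  apply: strong_Pytkeev_at_open_embedding PX; [exact: can_inj hK|exact: ch|].
  move=> V aV; suff : nbhs (h (set_val eA)) (g @^-1` V).
    by apply: filterS => y Vy; exists (g y).
  by apply: cg; rewrite hK.
Qed.
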